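(* Let $m \ge 2$. For $\mathbf{s} = (\mathbf{s}_1,\ldots,\mathbf{s}_m) \in \mathbb{R}^{U\times m}$ (each $\mathbf{s}_i \in \mathbb{R}^U$) define $$\Pi(\mathbf{s}) = \Lambda(\mathbf{s}_1) - \sum_{i=2}^m \Lambda(\mathbf{s}_i)\,\Lambda(\mathbf{s}_1)^{-1}\,\Lambda(\mathbf{s}_i) \in \mathbb{S}^L$$ whenever $\Lambda(\mathbf{s}_1)$ is invertible, and let $$K^\ast_{\ell_2} = \operatorname{cl}\{\mathbf{s} \in \mathbb{R}^{U\times m} : \Lambda(\mathbf{s}_1) \succ 0,\ \Pi(\mathbf{s}) \succ 0\}.$$ Then the function $F(\mathbf{s}) = -\log\det \Pi(\mathbf{s}) - \log\det \Lambda(\mathbf{s}_1)$, defined on $\{\mathbf{s} : \Lambda(\mathbf{s}_1)\succ 0,\ \Pi(\mathbf{s})\succ 0\}$ (the interior of $K^\ast_{\ell_2}$), is a $2L$-logarithmically homogeneous self-concordant barrier for $K^\ast_{\ell_2}$.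
   Context: Fix integers $n,d\ge 1$, and set $L=\binom{n+d}{n}$, $U=\binom{n+2d}{n}$. Let $\mathbf{t}_1,\ldots,\mathbf{t}_U\in\mathbb{R}^n$ be points that are unisolvent for $\mathbb{R}[\mathbf{x}]_{n,2d}$ (the polynomials in $n$ variables of degree at most $2d$), i.e. a polynomial of degree at most $2d$ vanishing at all of them is zero, and let $p_1,\ldots,p_L$ be a basis of $\mathbb{R}[\mathbf{x}]_{n,d}$. Let $\mathbf{P}\in\mathbb{R}^{U\times L}$ with $P_{u,\ell}=p_\ell(\mathbf{t}_u)$, and define the linear map $\Lambda:\mathbb{R}^U\to\mathbb{S}^L$ by $\Lambda(\mathbf{s})=\mathbf{P}^\top\operatorname{Diag}(\mathbf{s})\mathbf{P}$, where $\mathbb{S}^L$ denotes the real symmetric $L\times L$ matrices. A function $F$ on the interior of a closed convex cone $K$ with nonempty interior is a $\nu$-logarithmically homogeneous self-concordant barrier ($\nu$-LHSCB) if it is $C^3$ and convex, $F(\mathbf{x}_k)\to\infty$ whenever $\mathbf{x}_k$ converges to a point on the boundary of $K$, $|D^3F(\mathbf{x})[\mathbf{h},\mathbf{h},\mathbf{h}]|\le 2\,(D^2F(\mathbf{x})[\mathbf{h},\mathbf{h}])^{3/2}$ for all interior $\mathbf{x}$ and all directions $\mathbf{h}$, and $F(\tau\mathbf{x})=F(\mathbf{x})-\nu\log\tau$ for all $\tau>0$. *)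

(* Defs.v *)
From HB Require Import structures.
From mathcomp Require Import all_boot all_order all_algebra.
From mathcomp Require Import mpoly.
From mathcomp Require Import all_classical all_reals all_analysis.
Set Implicit Arguments. Unset Strict Implicit. Unset Printing Implicit Defensive.
Import Order.TTheory GRing.Theory Num.Theory.
Import numFieldNormedType.Exports.
Local Open Scope classical_set_scope.
Local Open Scope ring_scope.

Notation mpolyR n R := (mpoly.mpoly n R).

(* total degree bound: deg q <= k  <->  msize q <= k+1 (msize 0 = 0) *)
Definition deg_le (R : realType) (n k : nat) (q : mpolyR n R) : Prop :=
  (mpoly.msize q <= k.+1)%N.

Definition unisolvent (R : realType) (n k U : nat) (t : 'I_U -> 'I_n -> R) : Prop :=
  forall q : mpolyR n R, deg_le k q ->
    (forall u, mpoly.meval (t u) q = 0) -> q = 0.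

Definition is_basis_polys (R : realType) (n d L : nat) (p : 'I_L -> mpolyR n R) : Prop :=
  [/\ forall l, deg_le d (p l),
      forall a : 'I_L -> R, \sum_(l < L) a l *: p l = 0 -> forall l, a l = 0
    & forall q : mpolyR n R, deg_le d q ->
        exists a : 'I_L -> R, q = \sum_(l < L) a l *: p l].

Definition evmx (R : realType) (n U L : nat) (t : 'I_U -> 'I_n -> R)
  (p : 'I_L -> mpolyR n R) : 'M[R]_(U, L) :=
  \matrix_(u < U, l < L) mpoly.meval (t u) (p l).

Definition Lam (R : realType) (U L : nat) (P : 'M[R]_(U, L)) (s : 'cV[R]_U) : 'M[R]_L :=
  P^T *m diag_mx s^T *m P.

Definition posdef (R : realType) (L : nat) (A : 'M[R]_L) : Prop :=
  A^T = A /\ forall x : 'cV[R]_L, x != 0 -> 0 < (x^T *m A *m x) 0 0.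

(* Lambda(s_1), with s_1 the first column (index 0) of s *)
Definition Lam1 (R : realType) (U L m : nat) (P : 'M[R]_(U, L)) (s : 'M[R]_(U, m))
  : 'M[R]_L := \sum_(j < m | (j : nat) == 0%N) Lam P (col j s).

Definition Pi (R : realType) (U L m : nat) (P : 'M[R]_(U, L)) (s : 'M[R]_(U, m))
  : 'M[R]_L :=
  Lam1 P s - \sum_(j < m | (0 < j)%N) (Lam P (col j s) *m invmx (Lam1 P s) *m Lam P (col j s)).

Definition Kint (R : realType) (U L m : nat) (P : 'M[R]_(U, L)) : set 'M[R]_(U, m) :=
  [set s | posdef (Lam1 P s) /\ posdef (Pi P s)].

Arguments Kint {R U L} m P.

Definition Kstar (R : realType) (U L m : nat) (P : 'M[R]_(U, L)) : set 'M[R]_(U, m) :=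
  closure (Kint m P).
Arguments Kstar {R U L} m P.

Definition Fbar (R : realType) (U L m : nat) (P : 'M[R]_(U, L)) (s : 'M[R]_(U, m)) : R :=
  - ln (\det (Pi P s)) - ln (\det (Lam1 P s)).

Definition dd (R : realType) (V : normedModType R) (h : V) (f : V -> R) : V -> R :=
  fun x => 'D_h f x.

(* C^3 on an open set D: all iterated directional derivatives up to order 3
   exist and are continuous on D (finite-dimensional space). *)
Definition C3_on (R : realType) (V : normedModType R) (D : set V) (F : V -> R) : Prop :=
  forall h1 h2 h3 : V, forall x, D x ->
    {for x, continuous F} /\ derivable F x h1 /\
    {for x, continuous (dd h1 F)} /\ derivable (dd h1 F) x h2 /\
    {for x, continuous (dd h2 (dd h1 F))} /\ derivable (dd h2 (dd h1 F)) x h3 /\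
    {for x, continuous (dd h3 (dd h2 (dd h1 F)))}.

Definition closed_convex_cone (R : realType) (V : normedModType R) (K : set V) : Prop :=
  [/\ closed K,
      (forall x y l, K x -> K y -> 0 <= l <= 1 -> K (l *: x + (1 - l) *: y)),
      (forall x tau, K x -> 0 <= tau -> K (tau *: x))
    & interior K !=set0].

Definition LHSCB (R : realType) (V : normedModType R) (K : set V) (F : V -> R) (nu : R)
  : Prop :=
  closed_convex_cone K /\
  C3_on (interior K) F /\
  [/\ (forall x y l, interior K x -> interior K y -> 0 <= l <= 1 ->
         F (l *: x + (1 - l) *: y) <= l * F x + (1 - l) * F y),
      (forall (u : nat -> V) (x : V), (forall k, interior K (u k)) ->
         u @ \oo --> x -> K x -> ~ interior K x -> (F \o u) @ \oo --> +oo),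
      (forall x h, interior K x ->
         `| dd h (dd h (dd h F)) x | <= 2 * (dd h (dd h F) x) `^ (3 / 2))
    & (forall x tau, interior K x -> 0 < tau -> F (tau *: x) = F x - nu * ln tau)].

(* Main.v *)
Require Import Defs.
From HB Require Import structures.
From mathcomp Require Import all_boot all_order all_algebra.
From mathcomp Require Import mpoly.
From mathcomp Require Import all_classical all_reals all_analysis.
From mathcomp Require Import perm ring lra.
Set Implicit Arguments. Unset Strict Implicit. Unset Printing Implicit Defensive.
Import Order.TTheory GRing.Theory Num.Theory.
Import numFieldNormedType.Exports.
Local Open Scope classical_set_scope.
Local Open Scope ring_scope.

(** Write [X = Lam1 P s], [Y_j = Lam P (col j s)] and [S = Pi P s], the Schur complement of
    the block arrow matrix with diagonal blocks [X] and border blocks [- Y_j]. The quadratic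
    form of that matrix is linear in [s] and, after completing the square, characterises [Kint]
    by positivity and [Kstar] by nonnegativity, which settles all the convex geometry.

    In a direction where [X' = H], [Y_j' = K_j], put [A = S'] and
    [Z_j = K_j - H X^-1 Y_j]. Then [S'' = - 2 Q] and [Q' = - 3 T] with
    [Q = \sum_j Z_j^T X^-1 Z_j] and [T = \sum_j Z_j^T X^-1 H X^-1 Z_j], so with [B = S^-1 A]
    and [C = X^-1 H] the barrier satisfies
      [F''  = tr B^2 + 2 tr (S^-1 Q) + tr C^2],
      [F''' = - 2 tr B^3 - 6 tr (B S^-1 Q) - 6 tr (S^-1 T) - 2 tr C^3].
    Cholesky factors of [S] and [X] turn these traces into Frobenius products; with
    [a^2 = tr B^2], [h^2 = tr C^2], [q = tr (S^-1 Q)] self-concordance reduces to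
    [a^3 + h^3 + 3 (a + h) q <= (a^2 + h^2 + 2 q)^(3/2)]. *)

(** * Frobenius norm: Cauchy-Schwarz and submultiplicativity *)

Section Frobenius.
Variable R : realType.

(** With [p], [q], [r] the three sums, the nonnegative sum of the squares [(r * a i - p * b i) ^+ 2]
    equals [r * (q * r - p ^+ 2)]. The factor [r] cancels unless it is zero, and then every [b i]
    vanishes. *)
Lemma sum_cauchy_schwarz (I : finType) (a b : I -> R) :
  (\sum_i a i * b i) ^+ 2 <= (\sum_i a i ^+ 2) * (\sum_i b i ^+ 2).
Proof.
set p := \sum_i a i * b i; set q := \sum_i a i ^+ 2; set r := \sum_i b i ^+ 2.
have r0 : 0 <= r by apply: sumr_ge0 => i _; exact: sqr_ge0.
have [r_eq0|rN0] := eqVneq r 0.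
  suff -> : p = 0 by rewrite r_eq0 mulr0 expr0n.
  rewrite /p big1// => i _.
  have := psumr_eq0P (fun i _ => sqr_ge0 (b i)) r_eq0 (i := i) isT.
  by move/eqP; rewrite sqrf_eq0 => /eqP ->; rewrite mulr0.
have rgt0 : 0 < r by rewrite lt_neqAle eq_sym rN0.
have : 0 <= \sum_i (r * a i - p * b i) ^+ 2 by apply: sumr_ge0 => i _; exact: sqr_ge0.
have -> : \sum_i (r * a i - p * b i) ^+ 2 = r * (q * r - p ^+ 2).
  under eq_bigr => i _.
    rewrite (_ : (_ - _) ^+ 2 =
       r ^+ 2 * a i ^+ 2 - (2 * r * p) * (a i * b i) + p ^+ 2 * b i ^+ 2); last by ring.
    over.
  by rewrite big_split/= sumrB -!mulr_sumr -/p -/q -/r; ring.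
by rewrite pmulr_rge0// subr_ge0.
Qed.

Definition frob m n (A : 'M[R]_(m, n)) : R := Num.sqrt (\tr (A^T *m A)).

Lemma trace_trmulE m n (A B : 'M[R]_(m, n)) :
  \tr (A^T *m B) = \sum_i A i.1 i.2 * B i.1 i.2.
Proof.
rewrite /mxtrace -(pair_bigA _ (fun i j => A i j * B i j))/= exchange_big/=.
by apply: eq_bigr => j _; rewrite mxE; apply: eq_bigr => i _; rewrite mxE.
Qed.

Lemma trace_sqr m n (A : 'M[R]_(m, n)) : \tr (A^T *m A) = \sum_i A i.1 i.2 ^+ 2.
Proof. by rewrite trace_trmulE; apply: eq_bigr => i _; rewrite expr2. Qed.

Lemma trace_sqr_ge0 m n (A : 'M[R]_(m, n)) : 0 <= \tr (A^T *m A).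
Proof. by rewrite trace_sqr sumr_ge0// => i _; exact: sqr_ge0. Qed.

Lemma frob_ge0 m n (A : 'M[R]_(m, n)) : 0 <= frob A.
Proof. exact: sqrtr_ge0. Qed.

Lemma frob_sqr m n (A : 'M[R]_(m, n)) : frob A ^+ 2 = \tr (A^T *m A).
Proof. by rewrite sqr_sqrtr// trace_sqr_ge0. Qed.

Lemma frob_cauchy_schwarz m n (A B : 'M[R]_(m, n)) :
  `|\tr (A^T *m B)| <= frob A * frob B.
Proof.
rewrite -ler_sqr ?nnegrE ?mulr_ge0 ?frob_ge0// exprMn !frob_sqr !trace_sqr.
by rewrite real_normK ?num_real// trace_trmulE sum_cauchy_schwarz.
Qed.

(** Cauchy-Schwarz is applied to each entry of the product, a row of [A] against a column of [B],
    and the squares are summed. *)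
Lemma frobM m n k (A : 'M[R]_(m, n)) (B : 'M[R]_(n, k)) :
  frob (A *m B) <= frob A * frob B.
Proof.
rewrite -ler_sqr ?nnegrE ?mulr_ge0 ?frob_ge0// exprMn !frob_sqr !trace_sqr.
rewrite -(pair_bigA _ (fun i j => A i j ^+ 2))/=.
rewrite -(pair_bigA _ (fun i j => B i j ^+ 2))/= [X in _ * X]exchange_big/=.
rewrite -(pair_bigA _ (fun i j => (A *m B) i j ^+ 2))/= mulr_suml.
apply: ler_sum => i _; rewrite mulr_sumr; apply: ler_sum => j _.
by rewrite mxE sum_cauchy_schwarz.
Qed.

Lemma trace_sqr_eq0 m n (A : 'M[R]_(m, n)) : \tr (A^T *m A) = 0 -> A = 0.
Proof.
rewrite trace_sqr => A0; apply/matrixP => i j; rewrite mxE.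
have /eqP := psumr_eq0P (fun i _ => sqr_ge0 (A i.1 i.2)) A0 (i := (i, j)) isT.
by rewrite sqrf_eq0 => /eqP.
Qed.

End Frobenius.

(** * Positive definite matrices: Cholesky factors, perturbation, the semidefinite boundary *)

Section PositiveDefinite.
Variable R : realType.

Definition qform n (A : 'M[R]_n) (x : 'cV[R]_n) : R := (x^T *m A *m x) 0 0.

Lemma qform_block n (a : 'M[R]_1) (b : 'rV[R]_n) (C : 'M[R]_n) y x :
  qform (block_mx a b b^T C) (col_mx y x) =
  (y^T *m a *m y) 0 0 + 2 * (y^T *m b *m x) 0 0 + qform C x.
Proof.
rewrite /qform tr_col_mx -mulmxA mul_block_col mul_row_col !mulmxDr !mulmxA.
have -> : x^T *m b^T *m y = (y^T *m b *m x)^T by rewrite !trmx_mul trmxK mulmxA.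
set u := y^T *m a *m y; set v := y^T *m b *m x; set w := x^T *m C *m x.
by rewrite !mxE; ring.
Qed.

(** A nonzero kernel vector would make the quadratic form vanish. [kermx] is a left kernel, hence
    the transposes. *)
Lemma posdef_unit n (A : 'M[R]_n) : posdef A -> A \in unitmx.
Proof.
move=> [_ Apos]; rewrite -unitmx_tr -row_free_unit; apply/row_freeP.
have : kermx A^T = 0.
  apply/row_matrixP => i; rewrite row0; apply/eqP/negPn/negP => kN0.
  have : (row i (kermx A^T))^T != 0 by rewrite trmx_eq0.
  move=> /Apos; rewrite trmxK.
  have : row i (kermx A^T) *m A^T = 0 by rewrite -row_mul mulmx_ker row0.
  by move=> /(congr1 trmx); rewrite trmx_mul trmxK trmx0 -mulmxA => ->; rewrite mulmx0 mxE ltxx.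
by move=> /eqP; rewrite kermx_eq0 => /row_freeP.
Qed.

(* The Schur complement is positive definite because its form at [x] is the form of
   the whole matrix at [(- a^-1 b x, x)]. *)
Lemma cholesky n (A : 'M[R]_n) : posdef A -> exists2 M, M \in unitmx & A = M^T *m M.
Proof.
elim: n A => [A _|n IH A]; first by exists 1%:M; [exact: unitmx1|by apply/matrixP; case].
rewrite -[n.+1]add1n in A * => -[].
rewrite -[A]submxK; set a := ulsubmx A; set b := ursubmx A; set c := dlsubmx A; set C := drsubmx A.
rewrite tr_block_mx => /eq_block_mx [_ _ <- CT] Apos.
have a00 : 0 < a 0 0.
  have /Apos : col_mx 1 0 != 0 :> 'cV[R]_(1 + n).
    apply/eqP => /matrixP /(_ (lshift _ 0) 0); rewrite col_mxEu !mxE/= => /eqP.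
    by rewrite oner_eq0.
  rewrite -/(qform _ _) qform_block /qform mulmx0 mulmx0 trmx1 mul1mx mulmx1 !mxE.
  by rewrite mulr0 !addr0.
pose s := Num.sqrt (a 0 0).
have s0 : 0 < s by rewrite sqrtr_gt0.
have sN0 : s != 0 by rewrite gt_eqF.
have sE : s * s = a 0 0 by rewrite -expr2 sqr_sqrtr// ltW.
have [] := IH (C - (a 0 0)^-1 *: (b^T *m b)).
  split; first by rewrite linearB/= [(_ *: _)^T]linearZ/= trmx_mul trmxK CT.
  move=> x xN0; pose y : 'M[R]_1 := - (a 0 0)^-1 *: (b *m x).
  have /Apos : col_mx y x != 0 by rewrite col_mx_eq0 negb_and xN0 orbT.
  rewrite -/(qform _ _) qform_block.
  have -> : y^T *m a *m y = (a 0 0)^-1 *: ((b *m x)^T *m (b *m x)).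
    rewrite {1}[a]mx11_scalar mul_mx_scalar /y -scalemxAl -scalemxAr.
    rewrite [(_ *: _)^T]linearZ/= -scalemxAl !scalerA.
    by congr (_ *: _); field; rewrite gt_eqF.
  have -> : y^T *m b *m x = - (a 0 0)^-1 *: ((b *m x)^T *m (b *m x)).
    by rewrite /y [(_ *: _)^T]linearZ/= -2!scalemxAl mulmxA.
  rewrite /qform mulmxBr mulmxBl -scalemxAr -scalemxAl trmx_mul !mulmxA.
  set u := x^T *m C *m x; set v := _ *m x; rewrite !mxE.
  by congr (_ < _); ring.
move=> N Nunit CE.
(* The upper triangular factor: the square root of the pivot, the first row scaled by it, and the
   factor of the Schur complement. *)
exists (block_mx s%:M (s^-1 *: b) 0 N).
  by rewrite unitmxE det_ublock det_scalar1 unitrM unitfE sN0/=.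
rewrite tr_block_mx mulmx_block tr_scalar_mx trmx0 !mul0mx !mulmx0 !addr0 -CE.
rewrite [(_ *: _)^T]linearZ/= -scalar_mxM sE -mx11_scalar mul_scalar_mx mul_mx_scalar.
rewrite -scalemxAl -scalemxAr !scalerA mulfV// !scale1r -invfM sE.
by congr block_mx; rewrite addrC subrK.
Qed.

Lemma posdef_det_gt0 n (A : 'M[R]_n) : posdef A -> 0 < \det A.
Proof.
move=> /cholesky[M Mu ->]; rewrite det_mulmx det_tr -expr2 exprn_even_gt0//=.
by rewrite -unitfE -unitmxE.
Qed.

Lemma qformD n (A B : 'M[R]_n) x : qform (A + B) x = qform A x + qform B x.
Proof. by rewrite /qform mulmxDr mulmxDl mxE. Qed.

Lemma posdef_ge0 n (A : 'M[R]_n) x : posdef A -> 0 <= qform A x.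
Proof.
move=> [_ Apos]; have [->|/Apos/ltW//] := eqVneq x 0.
by rewrite /qform mulmx0 mxE.
Qed.

Lemma trace_mx11 (A : 'M[R]_1) : \tr A = A 0 0.
Proof. by rewrite /mxtrace big_ord1. Qed.

(* Conjugating by [M] turns [B] into a perturbation of the identity. *)
Lemma posdef_perturb n (M B : 'M[R]_n) : M \in unitmx -> B^T = B ->
  frob ((invmx M)^T *m (B - M^T *m M) *m invmx M) < 1 -> posdef B.
Proof.
set E := _ *m invmx M => Mu BT E1; split=> // x xN0.
pose y := M *m x.
have yN0 : y != 0.
  apply: contra xN0 => /eqP y0; apply/eqP.
  by rewrite -[x](mulKmx Mu) -/y y0 mulmx0.
have -> : x^T *m B *m x = y^T *m y + y^T *m (E *m y).
  rewrite /E /y trmx_mul !mulmxA -!(mulmxA (x^T)) -(trmx_mul (invmx M) M) mulVmx// trmx1.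
  by rewrite mul1mx -!mulmxA mulKmx// mulmxBl !mulmxBr !mulmxA addrC subrK.
rewrite mxE -!trace_mx11 -frob_sqr.
have ypos : 0 < frob y.
  rewrite lt_neqAle frob_ge0 andbT eq_sym; apply: contra yN0 => /eqP y0.
  by apply/eqP/trace_sqr_eq0; rewrite -frob_sqr y0 expr0n.
have : `|\tr (y^T *m (E *m y))| < frob y ^+ 2.
  apply: le_lt_trans (frob_cauchy_schwarz _ _) _; rewrite expr2 ltr_pM2l//.
  by apply: le_lt_trans (frobM _ _) _; rewrite gtr_pMl.
by rewrite ltr_norml => /andP[+ _]; rewrite -subr_gt0 opprK addrC.
Qed.

(** A zero [x] of a nonnegative form minimises it, so the gradient [A *m x] must vanish;
    invertibility then gives [x = 0]. The gradient is tested by moving from [x] along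
    [w = A *m x]. *)
Lemma possemidef_unit_posdef n (A : 'M[R]_n) : A^T = A -> A \in unitmx ->
  (forall x, 0 <= qform A x) -> posdef A.
Proof.
move=> AT Au A0; split=> // x xN0; rewrite lt_neqAle A0 andbT eq_sym.
apply: contra xN0 => /eqP qx0; apply/eqP.
rewrite -[x](mulKmx Au); set w := A *m x; suff -> : w = 0 by rewrite mulmx0.
have qE t : qform A (x + t *: w) = 2 * t * \tr (w^T *m w) + t ^+ 2 * qform A w.
  rewrite /qform [(x + _)^T]linearD/= [(_ *: _)^T]linearZ/= !mulmxDl !mulmxDr.
  rewrite -!scalemxAl -!scalemxAr.
  have -> : x^T *m A *m w = w^T *m w by rewrite /w trmx_mul AT.
  have -> : w^T *m A *m x = w^T *m w by rewrite -mulmxA.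
  rewrite trace_mx11; move: (x^T *m A *m x) (w^T *m w) (w^T *m A *m w) qx0 => p u v p0.
  by rewrite !mxE p0; ring.
apply: trace_sqr_eq0; apply/eqP; rewrite eq_le trace_sqr_ge0 andbT leNgt; apply/negP => T0.
set T := \tr _ in T0 qE; have q0 := A0 w.
(* A step against the gradient makes the form negative. Adding [T] to [qform A w] keeps the
   denominator positive even if [w] is a zero of the form. *)
have := A0 (x + (- (T / (qform A w + T))) *: w); rewrite qE.
have D0 : 0 < qform A w + T by rewrite ltr_wpDl.
set r := T / _; have r0 : 0 < r by rewrite divr_gt0.
have rE : r * (qform A w + T) = T by rewrite /r divfK// gt_eqF.
have : 2 * - r * T + (- r) ^+ 2 * qform A w < 0; last by rewrite ltNge => /negP.
have -> : 2 * - r * T + (- r) ^+ 2 * qform A w = - (r * (T + r * T)).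
  have rq : r * qform A w = T - r * T by apply/eqP; rewrite eq_sym subr_eq -mulrDr rE.
  rewrite sqrrN expr2 -[r * r * _]mulrA rq; ring.
by rewrite oppr_lt0 mulr_gt0// addr_gt0// mulr_gt0.
Qed.

End PositiveDefinite.

(** * The trace inequality behind self-concordance *)

Section SelfConcordanceBound.
Variable R : realType.

Lemma powR32 (w : R) : 0 <= w -> (w ^+ 2) `^ (3 / 2) = w ^+ 3.
Proof.
move=> w0; rewrite -powR_mulrn// -powRrM.
by rewrite (_ : 2%:R * (3 / 2) = 3%:R) ?powR_mulrn//; lra.
Qed.

(* With [s = a + h] and [w^2 = a^2 + h^2 + 2 q] the left-hand side is
   [(3 s w^2 - s^3) / 2], which is maximal at [s = w]. *)
Lemma cubic_bound (a h q : R) : 0 <= a -> 0 <= h -> 0 <= q ->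
  a ^+ 3 + h ^+ 3 + 3 * (a + h) * q <= (a ^+ 2 + h ^+ 2 + 2 * q) `^ (3 / 2).
Proof.
move=> a0 h0 q0; have N0 : 0 <= a ^+ 2 + h ^+ 2 + 2 * q.
  by rewrite !addr_ge0 ?sqr_ge0// mulr_ge0.
set w := Num.sqrt (a ^+ 2 + h ^+ 2 + 2 * q).
have w0 : 0 <= w by exact: sqrtr_ge0.
have wE : w ^+ 2 = a ^+ 2 + h ^+ 2 + 2 * q by rewrite sqr_sqrtr.
rewrite -wE powR32// -subr_ge0.
have -> : w ^+ 3 - (a ^+ 3 + h ^+ 3 + 3 * (a + h) * q) =
          (w - (a + h)) ^+ 2 * (w + (a + h) / 2).
  have -> : q = (w ^+ 2 - a ^+ 2 - h ^+ 2) / 2 by rewrite wE; field.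
  by field.
by rewrite mulr_ge0 ?sqr_ge0// addr_ge0// divr_ge0// addr_ge0.
Qed.

Variables (L : nat) (I : finType) (D : pred I).
Variables (S X A H : 'M[R]_L) (Z : I -> 'M[R]_L).
Hypotheses (Spos : posdef S) (Xpos : posdef X) (AT : A^T = A) (HT : H^T = H).

Let B := invmx S *m A.
Let C := invmx X *m H.
Let Q := \sum_(i | D i) (Z i)^T *m invmx X *m Z i.
Let T := \sum_(i | D i) (Z i)^T *m invmx X *m H *m invmx X *m Z i.

(** After normalising by the Cholesky factors, cyclicity turns the second-order traces into squared
    Frobenius norms. The cubic traces are at most [a^3] and [h^3], the mixed ones at most [a q] and
    [h q], so that [cubic_bound] applies. *)
Lemma self_concordance_bound :
  0 <= \tr (B *m B) + 2 * \tr (invmx S *m Q) + \tr (C *m C) /\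
  `|- 2 * \tr (B *m B *m B) - 6 * \tr (B *m invmx S *m Q) - 6 * \tr (invmx S *m T)
    - 2 * \tr (C *m C *m C)| <=
  2 * (\tr (B *m B) + 2 * \tr (invmx S *m Q) + \tr (C *m C)) `^ (3 / 2).
Proof.
have [M Mu SE] := cholesky Spos; have [N Nu XE] := cholesky Xpos.
have invE (K : 'M[R]_L) : K \in unitmx -> invmx (K^T *m K) = invmx K *m (invmx K)^T.
  move=> Ku; have KTu : K^T \in unitmx by rewrite unitmx_tr.
  have KKu : K^T *m K \in unitmx by rewrite unitmx_mul KTu.
  by apply: (can_inj (mulKmx KKu)); rewrite mulmxV// -mulmxA mulKVmx// -trmx_mul mulVmx// trmx1.
set Mi := invmx M; set Ni := invmx N.
have SiE : invmx S = Mi *m Mi^T by rewrite SE invE.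
have XiE : invmx X = Ni *m Ni^T by rewrite XE invE.
(* These are [A], [H] and [Z i] in coordinates where [S] and [X] become the identity; [W i] is
   normalised by [N] on the left and by [M] on the right. *)
pose A' := Mi^T *m A *m Mi; pose H' := Ni^T *m H *m Ni; pose W i := Ni^T *m Z i *m Mi.
have A'T : A'^T = A' by rewrite /A' !trmx_mul trmxK AT mulmxA.
have H'T : H'^T = H' by rewrite /H' !trmx_mul trmxK HT mulmxA.
have WT i : (W i)^T = Mi^T *m (Z i)^T *m Ni by rewrite /W !trmx_mul trmxK mulmxA.
have BB : \tr (B *m B) = frob A' ^+ 2.
  by rewrite frob_sqr A'T /B SiE /A' -!mulmxA [RHS]mxtrace_mulC -!mulmxA
    [LHS]mxtrace_mulC -!mulmxA [LHS]mxtrace_mulC -!mulmxA.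
have CC : \tr (C *m C) = frob H' ^+ 2.
  by rewrite frob_sqr H'T /C XiE /H' -!mulmxA [RHS]mxtrace_mulC -!mulmxA
    [LHS]mxtrace_mulC -!mulmxA [LHS]mxtrace_mulC -!mulmxA.
have cube (K E : 'M[R]_L) :
    \tr (K *m K^T *m E *m (K *m K^T *m E) *m (K *m K^T *m E)) =
    \tr (K^T *m E *m K *m (K^T *m E *m K *m (K^T *m E *m K))).
  by rewrite -!mulmxA [LHS]mxtrace_mulC -!mulmxA.
have BBB : \tr (B *m B *m B) = \tr (A' *m (A' *m A')) by rewrite /B SiE cube.
have CCC : \tr (C *m C *m C) = \tr (H' *m (H' *m H')) by rewrite /C XiE cube.
pose q := \sum_(i | D i) frob (W i) ^+ 2.
have q0 : 0 <= q by apply: sumr_ge0 => i _; exact: sqr_ge0.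
have SQ : \tr (invmx S *m Q) = q.
  rewrite /Q mulmx_sumr raddf_sum/=; apply: eq_bigr => i _.
  by rewrite frob_sqr WT SiE XiE /W -!mulmxA [LHS]mxtrace_mulC -!mulmxA.
have BSQ : \tr (B *m invmx S *m Q) = \sum_(i | D i) \tr (W i *m A' *m (W i)^T).
  rewrite /Q mulmx_sumr raddf_sum/=; apply: eq_bigr => i _.
  rewrite WT /B SiE XiE /A' /W -!mulmxA [RHS]mxtrace_mulC -!mulmxA.
  by rewrite [RHS]mxtrace_mulC -!mulmxA.
have ST : \tr (invmx S *m T) = \sum_(i | D i) \tr ((W i)^T *m (H' *m W i)).
  rewrite /T mulmx_sumr raddf_sum/=; apply: eq_bigr => i _.
  by rewrite WT SiE XiE /H' /W -!mulmxA [LHS]mxtrace_mulC -!mulmxA.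
have cube_le (E : 'M[R]_L) : E^T = E -> `|\tr (E *m (E *m E))| <= frob E ^+ 3.
  move=> ET; rewrite -{1}ET (le_trans (frob_cauchy_schwarz _ _))//.
  by rewrite exprS ler_wpM2l ?frob_ge0// expr2 frobM.
have BSQ_le : `|\tr (B *m invmx S *m Q)| <= frob A' * q.
  rewrite BSQ (le_trans (ler_norm_sum _ _ _))// /q mulr_sumr; apply: ler_sum => i _.
  rewrite mxtrace_mulC (le_trans (frob_cauchy_schwarz _ _))//.
  rewrite expr2 mulrCA ler_wpM2l ?frob_ge0// mulrC; exact: frobM.
have ST_le : `|\tr (invmx S *m T)| <= frob H' * q.
  rewrite ST (le_trans (ler_norm_sum _ _ _))// /q mulr_sumr; apply: ler_sum => i _.
  rewrite (le_trans (frob_cauchy_schwarz _ _))//.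
  by rewrite expr2 mulrCA ler_wpM2l ?frob_ge0// frobM.
have := cubic_bound (frob_ge0 A') (frob_ge0 H') q0.
have := cube_le _ A'T; have := cube_le _ H'T.
rewrite BB CC SQ -BBB -CCC (addrAC _ _ (frob H' ^+ 2)) => h1 h2 h3.
split; first by rewrite !addr_ge0 ?sqr_ge0// mulr_ge0.
(* The weights 2, 6, 6, 2 are twice the weights 1, 3, 3, 1 of [cubic_bound], so the rest is linear
   in the four bounds. *)
move: h1 h2 BSQ_le ST_le; rewrite !ler_norml => /andP[? ?] /andP[? ?] /andP[? ?] /andP[? ?].
by apply/andP; split; lra.
Qed.

End SelfConcordanceBound.

(** * Determinant and entry bounds from the Loewner order *)

Section DetBound.
Variable R : realType.

Lemma det_norm_le n (A : 'M[R]_n) (c : R) : (forall i j, `|A i j| <= c) ->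
  `|\det A| <= n`!%:R * c ^+ n.
Proof.
move=> Ac; rewrite /determinant (le_trans (ler_norm_sum _ _ _))//.
rewrite -card_Sn -sum1_card natr_sum mulr_suml; apply: ler_sum => s _.
rewrite mul1r normrM normrX normrN1 expr1n mul1r normr_prod.
rewrite -[X in _ ^+ X]card_ord -prodr_const; apply: ler_prod => i _.
by rewrite normr_ge0 Ac.
Qed.

Lemma qform_delta n (A : 'M[R]_n) i : qform A (delta_mx i 0) = A i i.
Proof.
rewrite /qform trmx_delta -rowE -colE.
by rewrite !mxE.
Qed.

Lemma qform_delta2 n (A : 'M[R]_n) i j (e : R) : A^T = A ->
  qform A (delta_mx i 0 + e *: delta_mx j 0) = A i i + 2 * e * A i j + e ^+ 2 * A j j.
Proof.
move=> AT; rewrite /qform [(delta_mx _ _ + _)^T]linearD/= [(_ *: _)^T]linearZ/=.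
rewrite !trmx_delta !mulmxDl !mulmxDr -!scalemxAl -!scalemxAr -!rowE -!colE.
by have := congr1 (fun E : 'M[R]_n => E i j) AT; rewrite !mxE => ->; ring.
Qed.

(** Nonnegativity of [A] at the sum and the difference of two basis vectors bounds [2 * A i j] in
    absolute value by [A i i + A j j]; the comparison with [B] is needed only on the diagonal. *)
Lemma loewner_entry_le n (A B : 'M[R]_n) i j : A^T = A ->
  (forall x, 0 <= qform A x <= qform B x) -> `|A i j| <= B i i + B j j.
Proof.
move=> AT AB.
have di k : 0 <= A k k <= B k k by have := AB (delta_mx k 0); rewrite !qform_delta.
have /andP[? ?] := di i; have /andP[? ?] := di j.
have /andP[p1 _] := AB (delta_mx i 0 + 1 *: delta_mx j 0).
have /andP[p2 _] := AB (delta_mx i 0 + (-1) *: delta_mx j 0).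
move: p1 p2; rewrite !qform_delta2// => p1 p2.
by rewrite ler_norml; apply/andP; split; lra.
Qed.

End DetBound.

(** * Rules for scalar directional derivatives *)

Section DirectionalDerivative.
Variables (R : realType) (V : normedModType R).
Implicit Types (f g : V -> R) (x v : V).

(** Both difference quotients are the same function of the increment. This gives access to
    one-variable results, namely the chain rule for [ln] and the convexity criterion. *)
Lemma is_derive_line f x v (t d : R) :
  is_derive (t *: v + x) v f d <-> is_derive t 1 (fun s : R => f (s *: v + x)) d.
Proof.
have E : (fun h : R => h^-1 *: ((f \o shift (t *: v + x)) (h *: v) - f (t *: v + x))) =
  (fun h : R => h^-1 *: (((fun s : R => f (s *: v + x)) \o shift t) (h *: (1 : R))
     - f (t *: v + x))).
  apply/funext => h /=; congr (_ *: (f _ - _)).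
  by rewrite addrA -scalerDl [h *: 1]mulr1.
by split=> -[]; rewrite /derivable /derive ?E -?E => d1 d2; split;
  rewrite /derivable /derive ?E -?E.
Qed.

Lemma is_deriveM_fun f g x v df dg : is_derive x v f df -> is_derive x v g dg ->
  is_derive x v (fun y => f y * g y) (df * g x + f x * dg).
Proof.
move=> h1 h2; have := is_deriveM h1 h2; rewrite addrC.
by rewrite -[_ *: df]mulrC.
Qed.

Lemma is_deriveV_fun f x v df : f x != 0 -> is_derive x v f df ->
  is_derive x v (fun y => (f y)^-1) (- (f x) ^- 2 * df).
Proof. by move=> fx0 [h <-]; split; [exact: derivableV|rewrite deriveV]. Qed.

Lemma is_derive_ln_fun f x v df : 0 < f x -> is_derive x v f df ->
  is_derive x v (fun y => ln (f y)) ((f x)^-1 * df).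
Proof.
move=> fx0 h; have {h} : is_derive (0 *: v + x) v f df by rewrite scale0r add0r.
move=> /is_derive_line h.
suff : is_derive (0 *: v + x) v (fun y => ln (f y)) ((f x)^-1 * df).
  by rewrite scale0r add0r.
apply/is_derive_line; apply: (@is_derive1_comp _ (@ln R) (fun s : R => f (s *: v + x))) => //.
by rewrite scale0r add0r; exact: is_derive1_ln.
Qed.

Lemma is_derive_sum_fun I (r : seq I) (P : pred I) (F : I -> V -> R) dF x v :
  (forall i, is_derive x v (F i) (dF i)) ->
  is_derive x v (fun y => \sum_(i <- r | P i) F i y) (\sum_(i <- r | P i) dF i).
Proof.
move=> h; elim: r => [|a r IH].
  rewrite big_nil; under eq_fun do rewrite big_nil; exact: is_derive_cst.
rewrite big_cons; under eq_fun do rewrite big_cons.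
by case: (P a) => //; exact: is_deriveD (h a) IH.
Qed.

(** Leibniz rule; [uniq] guarantees that the test [j == i] differentiates exactly one factor in each
    summand. *)
Lemma is_derive_prod_fun (I : eqType) (r : seq I) (F : I -> V -> R) dF x v :
  uniq r -> (forall i, is_derive x v (F i) (dF i)) ->
  is_derive x v (fun y => \prod_(i <- r) F i y)
    (\sum_(i <- r) \prod_(j <- r) (if j == i then dF j else F j x)).
Proof.
move=> + h; elim: r => [_|a r IH /= /andP[ar /IH {}IH]].
  rewrite big_nil; under eq_fun do rewrite big_nil; exact: is_derive_cst.
under eq_fun do rewrite big_cons.
apply: is_derive_eq (is_deriveM_fun (h a) IH) _.
rewrite big_cons big_cons eqxx; congr (_ * _ + _).
  rewrite [RHS]big_seq [LHS]big_seq; apply: eq_bigr => j jr.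
  by case: eqP => // ja; rewrite -ja jr in ar.
rewrite mulr_sumr [LHS]big_seq [RHS]big_seq; apply: eq_bigr => i ir.
by rewrite big_cons; case: eqP => // ai; rewrite ai ir in ar.
Qed.

Lemma is_derive_linear f x v : (forall (t : R) y z, f (t *: y + z) = t * f y + f z) ->
  is_derive x v f (f v).
Proof.
move=> lf; have c : (h^-1 *: ((f \o shift x) (h *: v) - f x)) @[h --> (0 : R)^'] --> f v.
  apply: cvg_near_cst; near=> h => /=.
  rewrite lf addrK [_ *: _]mulrA mulVf ?mul1r//; near: h; exact: nbhs_dnbhs_neq.
by split; [apply/cvg_ex; exists (f v)|exact: cvg_lim].
Unshelve. all: by end_near. Qed.

End DirectionalDerivative.

(** * Entrywise matrix calculus and Jacobi's formula *)

Section MatrixDerivative.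
Variables (R : realType) (V : normedModType R).
Implicit Types (x v : V).

(** Stated entry by entry, so that each matrix rule reduces to the scalar rules for sums and
    products. *)
Definition is_mderive m n x v (A : V -> 'M[R]_(m, n)) (A' : 'M[R]_(m, n)) :=
  forall i j, is_derive x v (fun y => A y i j) (A' i j).

Lemma is_mderive_cst m n x v (A : 'M[R]_(m, n)) : is_mderive x v (fun=> A) 0.
Proof. by move=> i j; rewrite mxE; exact: is_derive_cst. Qed.

Lemma is_mderive_eq m n x v (A : V -> 'M[R]_(m, n)) A' B' :
  is_mderive x v A A' -> A' = B' -> is_mderive x v A B'.
Proof. by move=> + <-. Qed.

Lemma is_mderive_near m n x v (A B : V -> 'M[R]_(m, n)) A' :
  (\forall y \near x, A y = B y) -> is_mderive x v A A' -> is_mderive x v B A'.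
Proof.
move=> AB h i j; apply: near_eq_is_derive (h i j).
by apply: filterS AB => y ->.
Qed.

Lemma is_mderiveD m n x v (A B : V -> 'M[R]_(m, n)) A' B' :
  is_mderive x v A A' -> is_mderive x v B B' ->
  is_mderive x v (fun y => A y + B y) (A' + B').
Proof.
move=> h k i j; rewrite mxE; under eq_fun do rewrite mxE.
exact: is_deriveD (h i j) (k i j).
Qed.

Lemma is_mderiveN m n x v (A : V -> 'M[R]_(m, n)) A' :
  is_mderive x v A A' -> is_mderive x v (fun y => - A y) (- A').
Proof.
move=> h i j; rewrite mxE; under eq_fun do rewrite mxE.
exact: is_deriveN (h i j).
Qed.

Lemma is_mderiveB m n x v (A B : V -> 'M[R]_(m, n)) A' B' :
  is_mderive x v A A' -> is_mderive x v B B' ->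
  is_mderive x v (fun y => A y - B y) (A' - B').
Proof. by move=> h k; apply: is_mderiveD => //; exact: is_mderiveN. Qed.

Lemma is_mderiveM m n p x v (A : V -> 'M[R]_(m, n)) (B : V -> 'M[R]_(n, p)) A' B' :
  is_mderive x v A A' -> is_mderive x v B B' ->
  is_mderive x v (fun y => A y *m B y) (A' *m B x + A x *m B').
Proof.
move=> h k i j; rewrite !mxE -big_split/=; under eq_fun do rewrite mxE.
by apply: is_derive_sum_fun => l; exact: is_deriveM_fun.
Qed.

Lemma is_mderive_tr m n x v (A : V -> 'M[R]_(m, n)) A' :
  is_mderive x v A A' -> is_mderive x v (fun y => (A y)^T) A'^T.
Proof. by move=> h i j; rewrite mxE; under eq_fun do rewrite mxE; exact: h. Qed.

Lemma is_mderive_sum m n x v I (r : seq I) (P : pred I) (A : I -> V -> 'M[R]_(m, n)) A' :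
  (forall i, is_mderive x v (A i) (A' i)) ->
  is_mderive x v (fun y => \sum_(i <- r | P i) A i y) (\sum_(i <- r | P i) A' i).
Proof.
move=> h i j; rewrite summxE; under eq_fun do rewrite summxE.
by apply: is_derive_sum_fun => k; exact: h.
Qed.

Lemma is_derive_trace n x v (A : V -> 'M[R]_n) A' :
  is_mderive x v A A' -> is_derive x v (fun y => \tr (A y)) (\tr A').
Proof. by move=> h; apply: is_derive_sum_fun => i; exact: h. Qed.

(** Jacobi's formula. Differentiating the permutation expansion gives the sum of the determinants in
    which one row of [A x] is replaced by that row of [A']; expanding each along the replaced row
    produces the cofactors of [A x]. *)
Lemma is_derive_det n x v (A : V -> 'M[R]_n) A' :
  is_mderive x v A A' -> is_derive x v (fun y => \det (A y)) (\tr (A' *m \adj (A x))).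
Proof.
move=> h; pose B i := \matrix_(k, l) (if k == i then A' k l else A x k l).
have -> : \tr (A' *m \adj (A x)) = \sum_i \det (B i).
  apply: eq_bigr => i _; rewrite (expand_det_row _ i) mxE; apply: eq_bigr => j _.
  rewrite !mxE eqxx; congr (_ * (_ * \det _)); apply/matrixP => k l; rewrite !mxE.
  by rewrite eq_sym (negbTE (neq_lift _ _)).
rewrite /determinant exchange_big/=; apply: is_derive_sum_fun => s.
rewrite -mulr_sumr.
have h1 : is_derive x v (fun=> (-1) ^+ s : R) 0 by exact: is_derive_cst.
apply: is_derive_eq (is_deriveM_fun h1 _) _.
- apply: (@is_derive_prod_fun _ _ _ _ (fun i y => A y i (s i))) => [|i]; last exact: h.
  exact: index_enum_uniq.
- rewrite mul0r add0r; congr (_ * _); apply: eq_bigr => i _; apply: eq_bigr => j _.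
  by rewrite mxE.
Qed.

Lemma adjE n (A : 'M[R]_n) : A \in unitmx -> \adj A = \det A *: invmx A.
Proof.
move=> Au; rewrite /invmx Au scalerA mulfV ?scale1r//.
by move: Au; rewrite unitmxE unitfE.
Qed.

Lemma is_derive_ln_det n x v (A : V -> 'M[R]_n) A' : 0 < \det (A x) ->
  is_mderive x v A A' -> is_derive x v (fun y => ln (\det (A y))) (\tr (invmx (A x) *m A')).
Proof.
move=> Apos /is_derive_det h.
apply: is_derive_eq (is_derive_ln_fun (f := fun y => \det (A y)) Apos h) _.
have Au : A x \in unitmx by rewrite unitmxE unitfE gt_eqF.
rewrite adjE// -scalemxAr mxtraceZ mulrA mulVf ?(gt_eqF Apos)// mul1r.
exact: mxtrace_mulC.
Qed.

End MatrixDerivative.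

(** * Functions of class C^k on an open set *)

Section ContinuouslyDifferentiable.
Variables (R : realType) (V : normedModType R) (D : set V).
Hypothesis oD : open D.
Implicit Types (f g : V -> R).

(** Directional derivatives in all directions do not imply continuity, so continuity is demanded at
    every level. The recursion lets closure under each operation be proved by induction on [k];
    order 3 yields [C3_on]. *)
Fixpoint Ck k f : Prop := (forall x, D x -> {for x, continuous f}) /\
  if k is k'.+1 then
    forall h, (forall x, D x -> derivable f x h) /\ Ck k' (dd h f)
  else True.

Lemma open_near x (P : V -> Prop) : D x -> (forall y, D y -> P y) -> \forall y \near x, P y.
Proof.
move=> Dx DP; have /filterS : nbhs x D by apply: open_nbhs_nbhs; split.
by apply.
Qed.

Lemma Ck_cont k f x : Ck k f -> D x -> {for x, continuous f}.
Proof. by case: k => [|k] [+ _]; exact. Qed.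

Lemma CkS_is_derive k f x h : Ck k.+1 f -> D x -> is_derive x h f (dd h f x).
Proof. by move=> [_ /(_ h)[+ _]] Dx => /(_ _ Dx)/derivableP. Qed.

Lemma CkS_dd k f h : Ck k.+1 f -> Ck k (dd h f).
Proof. by move=> [_ /(_ h)[]]. Qed.

(** Since [D] is open, functions equal on [D] are equal near each of its points and share limits and
    derivatives there. *)
Lemma Ck_ext k f g : (forall y, D y -> f y = g y) -> Ck k f -> Ck k g.
Proof.
elim: k f g => [|k IH] f g fg [fc fd].
  split=> // x Dx; have fgx : {near x, f =1 g} by exact: open_near.
  rewrite /prop_for /continuous_at -fg//.
  by apply: cvg_trans (fc _ Dx); exact: near_eq_cvg.
split=> [x Dx|h].
  have fgx : {near x, f =1 g} by exact: open_near.
  rewrite /prop_for /continuous_at -fg//.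
  by apply: cvg_trans (fc _ Dx); exact: near_eq_cvg.
have [fdh fCk] := fd h; split=> [x Dx|].
  by apply: near_eq_derivable (fdh _ Dx); exact: open_near.
apply: IH fCk => y Dy; apply: near_eq_derive; exact: open_near.
Qed.

Lemma Ck_le k f : Ck k.+1 f -> Ck k f.
Proof.
elim: k f => [|k IH] f [fc fd]; first by split.
by split=> // h; have [? /IH] := fd h.
Qed.

Lemma CkS_intro k f (f' : V -> V -> R) : (forall x, D x -> {for x, continuous f}) ->
  (forall h x, D x -> is_derive x h f (f' h x)) -> (forall h, Ck k (f' h)) -> Ck k.+1 f.
Proof.
move=> fc fd f'C; split=> // h; split=> [x /fd-/(_ h)//|].
by apply: Ck_ext (f'C h) => y /fd-/(_ h) [_ E]; rewrite /dd E.
Qed.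

Lemma Ck_cst k (c : R) : Ck k (fun=> c).
Proof.
have cc x : {for x, continuous (fun _ : V => c)} by exact: cst_continuous.
elim: k c cc => [|k IH] c cc; first by split.
have C0 : Ck k (fun=> 0) by apply: IH => x; exact: cst_continuous.
apply: (CkS_intro (f' := fun _ _ => 0)) => // x _; exact: cc.
Qed.

Lemma Ck_linear k f : continuous f ->
  (forall (t : R) y z, f (t *: y + z) = t * f y + f z) -> Ck k f.
Proof.
move=> fc fl; case: k => [|k]; first by split=> // x _; exact: fc.
apply: (CkS_intro (f' := fun h _ => f h)) => [x _|h x _|h]; first exact: fc.
  exact: is_derive_linear.
exact: Ck_cst.
Qed.

Lemma CkD k f g : Ck k f -> Ck k g -> Ck k (fun y => f y + g y).
Proof.
elim: k f g => [|k IH] f g fC gC.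
  by split=> // x Dx; apply: cvgD; [exact: Ck_cont fC Dx|exact: Ck_cont gC Dx].
apply: (CkS_intro (f' := fun h y => dd h f y + dd h g y)).
- by move=> x Dx; apply: cvgD; [exact: Ck_cont fC Dx|exact: Ck_cont gC Dx].
- by move=> h x Dx; exact: is_deriveD (CkS_is_derive h fC Dx) (CkS_is_derive h gC Dx).
- by move=> h; apply: IH; exact: CkS_dd.
Qed.

Lemma CkM k f g : Ck k f -> Ck k g -> Ck k (fun y => f y * g y).
Proof.
elim: k f g => [|k IH] f g fC gC.
  by split=> // x Dx; apply: cvgM; [exact: Ck_cont fC Dx|exact: Ck_cont gC Dx].
apply: (CkS_intro (f' := fun h y => dd h f y * g y + f y * dd h g y)).
- by move=> x Dx; apply: cvgM; [exact: Ck_cont fC Dx|exact: Ck_cont gC Dx].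
- by move=> h x Dx; exact: is_deriveM_fun (CkS_is_derive h fC Dx) (CkS_is_derive h gC Dx).
- by move=> h; apply: CkD; apply: IH; do ?[exact: CkS_dd|exact: Ck_le].
Qed.

Lemma CkX k n f : Ck k f -> Ck k (fun y => f y ^+ n).
Proof.
move=> fC; elim: n => [|n IH]; first exact: Ck_cst.
by under eq_fun do rewrite exprS; exact: CkM.
Qed.

Lemma CkN k f : Ck k f -> Ck k (fun y => - f y).
Proof.
move=> fC; apply: Ck_ext (CkM (Ck_cst k (-1)) fC) => y _.
by rewrite mulN1r.
Qed.

(** The derivative of [1/f] is a product of two copies of [1/f] and [dd h f], up to sign, so the
    induction hypothesis applies to each reciprocal. *)
Lemma CkV k f : (forall y, D y -> f y != 0) -> Ck k f -> Ck k (fun y => (f y)^-1).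
Proof.
move=> f0; elim: k => [|k IH] fC.
  by split=> // x Dx; apply: cvgV; [exact: f0|exact: Ck_cont fC Dx].
apply: (CkS_intro (f' := fun h y => - ((f y)^-1 * (f y)^-1 * dd h f y))).
- by move=> x Dx; apply: cvgV; [exact: f0|exact: Ck_cont fC Dx].
- move=> h x Dx; apply: is_derive_eq (is_deriveV_fun (f0 _ Dx) (CkS_is_derive h fC Dx)) _.
  by rewrite expr2 invfM mulNr.
- move=> h; apply: CkN; apply: CkM; last exact: CkS_dd.
  by apply: CkM; apply: IH; exact: Ck_le.
Qed.

Lemma Ck_ln k f : (forall y, D y -> 0 < f y) -> Ck k f -> Ck k (fun y => ln (f y)).
Proof.
move=> f0; case: k => [|k] fC.
  split=> // x Dx; apply: (@continuous_comp _ _ _ f (@ln R)); first exact: Ck_cont fC Dx.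
  exact/continuous_ln/f0.
apply: (CkS_intro (f' := fun h y => (f y)^-1 * dd h f y)).
- move=> x Dx; apply: (@continuous_comp _ _ _ f (@ln R)); first exact: Ck_cont fC Dx.
  exact/continuous_ln/f0.
- move=> h x Dx; exact: is_derive_ln_fun (f0 _ Dx) (CkS_is_derive h fC Dx).
- move=> h; apply: CkM; last exact: CkS_dd.
  by apply: CkV; [move=> y /f0; rewrite lt0r => /andP[]|exact: Ck_le].
Qed.

Lemma Ck_sum k I (r : seq I) (P : pred I) (F : I -> V -> R) :
  (forall i, Ck k (F i)) -> Ck k (fun y => \sum_(i <- r | P i) F i y).
Proof.
move=> h; elim: r => [|a r IH].
  by under eq_fun do rewrite big_nil; exact: Ck_cst.
under eq_fun do rewrite big_cons.
by case: (P a) => //; exact: CkD.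
Qed.

Lemma Ck_prod k I (r : seq I) (P : pred I) (F : I -> V -> R) :
  (forall i, Ck k (F i)) -> Ck k (fun y => \prod_(i <- r | P i) F i y).
Proof.
move=> h; elim: r => [|a r IH].
  by under eq_fun do rewrite big_nil; exact: Ck_cst.
under eq_fun do rewrite big_cons.
by case: (P a) => //; exact: CkM.
Qed.

Definition Ckmx k m n (A : V -> 'M[R]_(m, n)) := forall i j, Ck k (fun y => A y i j).

Lemma Ck_det k n (A : V -> 'M[R]_n) : Ckmx k A -> Ck k (fun y => \det (A y)).
Proof.
move=> CA; rewrite /determinant; apply: Ck_sum => s; apply: CkM; first exact: Ck_cst.
by apply: Ck_prod => i; exact: CA.
Qed.

Lemma Ckmx_cst k m n (A : 'M[R]_(m, n)) : Ckmx k (fun=> A).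
Proof. by move=> i j; exact: Ck_cst. Qed.

Lemma CkmxD k m n (A B : V -> 'M[R]_(m, n)) : Ckmx k A -> Ckmx k B ->
  Ckmx k (fun y => A y + B y).
Proof. by move=> CA CB i j; under eq_fun do rewrite mxE; exact: CkD. Qed.

Lemma CkmxN k m n (A : V -> 'M[R]_(m, n)) : Ckmx k A -> Ckmx k (fun y => - A y).
Proof. by move=> CA i j; under eq_fun do rewrite mxE; exact: CkN. Qed.

Lemma CkmxM k m n p (A : V -> 'M[R]_(m, n)) (B : V -> 'M[R]_(n, p)) :
  Ckmx k A -> Ckmx k B -> Ckmx k (fun y => A y *m B y).
Proof.
by move=> CA CB i j; under eq_fun do rewrite mxE; apply: Ck_sum => l; exact: CkM.
Qed.

Lemma Ckmx_sum k m n I (r : seq I) (P : pred I) (A : I -> V -> 'M[R]_(m, n)) :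
  (forall i, Ckmx k (A i)) -> Ckmx k (fun y => \sum_(i <- r | P i) A i y).
Proof.
by move=> CA i j; under eq_fun do rewrite summxE; apply: Ck_sum => l; exact: CA.
Qed.

(** By Cramer's rule the entries are cofactors over a determinant that does not vanish on [D]. *)
Lemma Ckmx_inv k n (A : V -> 'M[R]_n) : (forall y, D y -> A y \in unitmx) ->
  Ckmx k A -> Ckmx k (fun y => invmx (A y)).
Proof.
move=> Au CA i j.
apply: (@Ck_ext _ (fun y => (\det (A y))^-1 * cofactor (A y) j i)).
  by move=> y /Au Ayu; rewrite /invmx Ayu !mxE.
apply: CkM.
  by apply: CkV; [move=> y /Au; rewrite unitmxE unitfE|exact: Ck_det].
apply: CkM; first exact: Ck_cst.
by apply: Ck_det => p q; under eq_fun do rewrite !mxE; exact: CA.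
Qed.

(** Cramer's rule already shows that the derivative exists; its value is solved from the product
    rule for [A y *m invmx (A y)], which is constantly 1 near [x]. *)
Lemma is_mderive_inv n x v (A : V -> 'M[R]_n) A' : (forall y, D y -> A y \in unitmx) ->
  Ckmx 1 A -> D x -> is_mderive x v A A' ->
  is_mderive x v (fun y => invmx (A y)) (- invmx (A x) *m A' *m invmx (A x)).
Proof.
move=> Au CA Dx AA'.
pose B := \matrix_(i, j) dd v (fun y => invmx (A y) i j) x.
have BB : is_mderive x v (fun y => invmx (A y)) B.
  by move=> i j; rewrite mxE; apply: CkS_is_derive Dx; exact: Ckmx_inv.
apply: is_mderive_eq (BB) _.
have p1 : is_mderive x v (fun y => A y *m invmx (A y)) 0.
  apply: is_mderive_near (is_mderive_cst x v 1%:M); apply: open_near Dx _ => y /Au Ayu.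
  by rewrite mulmxV.
have p2 := is_mderiveM AA' BB.
have : A' *m invmx (A x) + A x *m B = 0.
  by apply/matrixP => i j; have [_ <-] := p2 i j; have [_ <-] := p1 i j.
move=> /addr0_eq E.
by rewrite -[LHS](mulKmx (Au _ Dx)) -E mulmxN mulmxA !mulNmx.
Qed.

End ContinuouslyDifferentiable.

(** * Derivatives of the barrier of a Schur complement *)

Section SchurBarrier.
Variables (R : realType) (V : normedModType R) (D : set V) (L : nat).
Variables (I : finType) (J : pred I) (X : V -> 'M[R]_L) (Y : I -> V -> 'M[R]_L).
Variables (h : V) (H : 'M[R]_L) (K : I -> 'M[R]_L).

(** Abstract form of [Pi]: about the direction [h], the calculus below uses only that [X] and the
    [Y i] have constant symmetric derivatives [H] and [K i]. *)
Definition schur (y : V) : 'M[R]_L :=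
  X y - \sum_(i | J i) (Y i y *m invmx (X y) *m Y i y).

Definition schur_barrier (y : V) : R := - ln (\det (schur y)) - ln (\det (X y)).

Hypotheses (oD : open D) (Xpos : forall y, D y -> posdef (X y)).
Hypothesis Spos : forall y, D y -> posdef (schur y).
Hypotheses (YT : forall i y, (Y i y)^T = Y i y) (HT : H^T = H) (KT : forall i, (K i)^T = K i).
Hypotheses (dX : forall y, is_mderive y h X H) (dY : forall i y, is_mderive y h (Y i) (K i)).
Hypotheses (CX : forall k, Ckmx D k X) (CY : forall i k, Ckmx D k (Y i)).

Let Xi y := invmx (X y).
Let Si y := invmx (schur y).
Let Z i y := K i - H *m (Xi y *m Y i y).
Let A y := H - \sum_(i | J i) (K i *m (Xi y *m Y i y) + Y i y *m (Xi y *m Z i y)).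
Let Q y := \sum_(i | J i) ((Z i y)^T *m Xi y *m Z i y).
Let T y := \sum_(i | J i) ((Z i y)^T *m Xi y *m H *m Xi y *m Z i y).
Let B y := Si y *m A y.
Let C y := Xi y *m H.

Lemma Ckmx_schur k : Ckmx D k schur.
Proof.
have CXi : Ckmx D k Xi.
  apply: Ckmx_inv => // y /Xpos; exact: posdef_unit.
apply: CkmxD => //; apply: CkmxN => //; apply: Ckmx_sum => // i.
by do 2!apply: CkmxM => //.
Qed.

Lemma Ck_schur_barrier k : Ck D k schur_barrier.
Proof.
apply: CkD => //; apply: CkN => //; apply: Ck_ln => //.
- by move=> y /Spos; exact: posdef_det_gt0.
- by apply: Ck_det => //; exact: Ckmx_schur.
- by move=> y /Xpos; exact: posdef_det_gt0.
- exact: Ck_det.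
Qed.

Let XiT y : D y -> (Xi y)^T = Xi y.
Proof. by move=> /Xpos[XT _]; rewrite /Xi trmx_inv XT. Qed.

Let ZT i y : D y -> (Z i y)^T = K i - Y i y *m Xi y *m H.
Proof. by move=> Dy; rewrite /Z linearB/= !trmx_mul KT HT YT XiT. Qed.

Let dXi y : D y -> is_mderive y h Xi (- Xi y *m H *m Xi y).
Proof. by move=> Dy; apply: is_mderive_inv Dy _ => // z /Xpos; exact: posdef_unit. Qed.

(** This is what [Z] is designed for: the two terms of the product rule for [X^-1 Y_i] combine into
    [X^-1 Z_i]. *)
Let dG i y : D y -> is_mderive y h (fun y => Xi y *m Y i y) (Xi y *m Z i y).
Proof.
move=> Dy; apply: is_mderive_eq (is_mderiveM (dXi Dy) (dY i y)) _.
by rewrite /Z mulmxBr !mulNmx !mulmxA addrC.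
Qed.

Let dZ i y : D y -> is_mderive y h (Z i) (- (H *m Xi y *m Z i y)).
Proof.
move=> Dy; apply: is_mderive_eq.
  exact: is_mderiveB (is_mderive_cst _ _ _) (is_mderiveM (is_mderive_cst _ _ _) (dG i Dy)).
by rewrite mul0mx !add0r mulmxA.
Qed.

Let dXiZ i y : D y -> is_mderive y h (fun y => Xi y *m Z i y)
  (- 2 *: (Xi y *m H *m Xi y *m Z i y)).
Proof.
move=> Dy; apply: is_mderive_eq (is_mderiveM (dXi Dy) (dZ i Dy)) _.
by rewrite !mulNmx mulmxN !mulmxA scaleNr scaler_nat mulr2n opprD.
Qed.

Let dS y : D y -> is_mderive y h schur (A y).
Proof.
move=> Dy; apply: is_mderive_eq.
  apply: is_mderiveB (dX y) _; apply: is_mderive_sum => i.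
  exact: is_mderiveM (is_mderiveM (dY i y) (dXi Dy)) (dY i y).
congr (_ - _); apply: eq_bigr => i _.
by rewrite mulmxDl /Z !mulmxBr !mulNmx !mulmxN !mulNmx !mulmxA -addrA; congr (_ + _); rewrite addrC.
Qed.

(** The product rule gives [2 K_i X^-1 Z_i - 2 Y_i X^-1 H X^-1 Z_i], and [K_i - Y_i X^-1 H] is the
    transpose of [Z_i]. *)
Let dA y : D y -> is_mderive y h A (- 2 *: Q y).
Proof.
move=> Dy; apply: is_mderive_eq.
  apply: is_mderiveB (is_mderive_cst _ _ _) _; apply: is_mderive_sum => i.
  apply: is_mderiveD.
    exact: is_mderiveM (is_mderive_cst _ _ _) (dG i Dy).
  exact: is_mderiveM (dY i y) (dXiZ i Dy).
rewrite add0r scaleNr scaler_sumr; congr (- _); apply: eq_bigr => i _.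
rewrite mul0mx add0r ZT// mulmxBl mulmxBl scalerBr addrA !mulmxA.
by rewrite -scalemxAr !mulmxA scaleNr; congr (_ - _); rewrite scaler_nat mulr2n.
Qed.

(** Each of the three factors of a summand of [Q] contributes the same term of [- T]. *)
Let dQ y : D y -> is_mderive y h Q (- 3 *: T y).
Proof.
move=> Dy; apply: is_mderive_eq.
  apply: is_mderive_sum => i.
  exact: is_mderiveM (is_mderiveM (is_mderive_tr (dZ i Dy)) (dXi Dy)) (dZ i Dy).
rewrite scaler_sumr; apply: eq_bigr => i _.
rewrite linearN/= !trmx_mul HT XiT// !(mulNmx, mulmxN) mulmxDl !(mulNmx, mulmxN) !mulmxA.
by rewrite scaleNr scaler_nat 2!mulrSr mulr1n !opprD.
Qed.

Let dSi y : D y -> is_mderive y h Si (- Si y *m A y *m Si y).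
Proof.
move=> Dy; apply: is_mderive_inv Dy (dS Dy) => // [z /Spos|]; first exact: posdef_unit.
exact: Ckmx_schur.
Qed.

Let dB y : D y -> is_mderive y h B (- (B y *m B y) - 2 *: (Si y *m Q y)).
Proof.
move=> Dy; apply: is_mderive_eq (is_mderiveM (dSi Dy) (dA Dy)) _.
by rewrite !mulNmx -scalemxAr scaleNr /B !mulmxA.
Qed.

Let dC y : D y -> is_mderive y h C (- (C y *m C y)).
Proof.
move=> Dy; apply: is_mderive_eq (is_mderiveM (dXi Dy) (is_mderive_cst _ _ H)) _.
by rewrite mulmx0 addr0 !mulNmx /C !mulmxA.
Qed.

Let mxtraceN (E : 'M[R]_L) : \tr (- E) = - \tr E.
Proof. exact: linearN. Qed.

Let f1 y := - \tr (B y) - \tr (C y).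
Let f2 y := \tr (B y *m B y) + 2 * \tr (Si y *m Q y) + \tr (C y *m C y).
Let f3 y := - 2 * \tr (B y *m B y *m B y) - 6 * \tr (B y *m Si y *m Q y)
  - 6 * \tr (Si y *m T y) - 2 * \tr (C y *m C y *m C y).

Let df0 y : D y -> is_derive y h schur_barrier (f1 y).
Proof.
move=> Dy; apply: is_deriveB; last first.
  by apply: is_derive_ln_det (dX y); exact/posdef_det_gt0/Xpos.
by apply: is_deriveN; apply: is_derive_ln_det (dS Dy); exact/posdef_det_gt0/Spos.
Qed.

Let df1 y : D y -> is_derive y h f1 (f2 y).
Proof.
move=> Dy; apply: is_derive_eq.
  exact: is_deriveB (is_deriveN (is_derive_trace (dB Dy))) (is_derive_trace (dC Dy)).
by rewrite mxtraceD !mxtraceN mxtraceZ /f2; ring.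
Qed.

Let df2 y : D y -> is_derive y h f2 (f3 y).
Proof.
move=> Dy; apply: is_derive_eq.
  apply: is_deriveD; last exact: is_derive_trace (is_mderiveM (dC Dy) (dC Dy)).
  apply: is_deriveD; first exact: is_derive_trace (is_mderiveM (dB Dy) (dB Dy)).
  exact: is_deriveZ (is_derive_trace (is_mderiveM (dSi Dy) (dQ Dy))).
rewrite mulmxBl mulmxBr !(mulNmx, mulmxN) -!(scalemxAl, scalemxAr).
rewrite !(mxtraceD, mxtraceN, mxtraceZ).
(* Cyclicity identifies the two orders of [B] and [S^-1 Q]: four copies come from [tr B^2] and two
   from [2 tr (S^-1 Q)], whence the coefficient 6. *)
rewrite (mxtrace_mulC (Si y *m Q y)) !mulmxA /f3 /B !mulmxA.
by rewrite /GRing.scale/=; ring.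
Qed.

Lemma schur_barrier_self_concordant x : D x ->
  0 <= dd h (dd h schur_barrier) x /\
  `|dd h (dd h (dd h schur_barrier)) x| <=
    2 * (dd h (dd h schur_barrier) x) `^ (3 / 2).
Proof.
have E1 y : D y -> dd h schur_barrier y = f1 y by move=> /df0[_ E]; exact: E.
(* The formula for the previous derivative holds on all of the open set [D], hence near [y], and may
   be differentiated in its place. *)
have E2 y : D y -> dd h (dd h schur_barrier) y = f2 y.
  move=> Dy; have [_ <-] := df1 Dy; apply: near_eq_derive; exact: (open_near oD).
have E3 y : D y -> dd h (dd h (dd h schur_barrier)) y = f3 y.
  move=> Dy; have [_ <-] := df2 Dy; apply: near_eq_derive; exact: (open_near oD).
move=> Dx; rewrite E3// E2//; apply: self_concordance_bound => //.
- exact: Spos.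
- exact: Xpos.
- rewrite /A linearB/= HT linear_sum/=; congr (_ - _); apply: eq_bigr => i _.
  rewrite linearD/= !trmx_mul KT YT XiT// ZT// /Z.
  by rewrite mulmxBl mulmxBl !mulmxBr !mulmxA addrCA.
Qed.

End SchurBarrier.

(** Used with [s0] to push a point of the closed cone into [Kint], and with [- s0] to step back from
    an interior point. *)
Lemma cvg_ray (R : realType) (V : normedModType R) (v s : V) :
  (t *: v + s) @[t --> (0 : R)^'+] --> s.
Proof.
rewrite -[X in _ --> X]add0r -(scale0r v); apply: cvgD; last exact: cvg_cst.
by apply: cvgZr_tmp; exact/cvg_at_right_filter/cvg_id.
Qed.

(** * Openness of positive definiteness *)

Section PosdefOpen.
Variables (R : realType) (V : normedModType R).

(** The squared Frobenius norm of the conjugated difference is continuous and zero at [x], so it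
    stays below 1 nearby and [posdef_perturb] applies. *)
Lemma open_posdef (D : set V) n (A : V -> 'M[R]_n) : open D -> Ckmx D 0 A ->
  (forall y, D y -> (A y)^T = A y) -> open [set y | D y /\ posdef (A y)].
Proof.
move=> oD CA AT; rewrite openE => x [Dx /[dup] Apos /cholesky[M Mu AE]].
pose E y := (invmx M)^T *m (A y - M^T *m M) *m invmx M.
have CE : Ckmx D 0 E.
  apply: CkmxM => //; last exact: Ckmx_cst.
  apply: CkmxM => //; first exact: Ckmx_cst.
  by apply: CkmxD => //; exact: Ckmx_cst.
pose f y := \tr ((E y)^T *m E y).
have Cf : Ck D 0 f.
  apply: Ck_sum => // i; apply: CkmxM => // j k.
  by under eq_fun do rewrite mxE; exact: CE.
have fx : f x = 0 by rewrite /f /E AE subrr mulmx0 mul0mx mulmx0 mxtrace0.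
have /cvgr_lt/(_ 1) : f y @[y --> x] --> f x by exact: Ck_cont Cf Dx.
rewrite fx ltr01 => /(_ isT) f1; near=> y.
have Dy : D y by near: y; apply: open_nbhs_nbhs; split.
split=> //; apply: posdef_perturb Mu _ _; first exact: AT.
rewrite -/(E y) -(@ltr_sqr _ _ 1) ?nnegrE ?frob_ge0// frob_sqr expr1n.
by near: y.
Unshelve. all: by end_near. Qed.

End PosdefOpen.

(** * Geometry of the cone through the arrow form *)

Section Cone.
Variables (R : realType) (U L m : nat) (P : 'M[R]_(U, L)).
Hypotheses (Pfull : forall v : 'cV[R]_L, P *m v = 0 -> v = 0) (m0 : (0 < m)%N).
Local Notation V := 'M[R]_(U, m).
Implicit Types (s h : V).
Let Y (j : 'I_m) s := Lam P (col j s).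
Let X s := Lam1 P s.

Lemma Lam_linear (t : R) (a b : 'cV[R]_U) : Lam P (t *: a + b) = t *: Lam P a + Lam P b.
Proof.
by rewrite /Lam !linearP/= mulmxDl -scalemxAl.
Qed.

Lemma Lam_sym (a : 'cV[R]_U) : (Lam P a)^T = Lam P a.
Proof. by rewrite /Lam !trmx_mul trmxK tr_diag_mx mulmxA. Qed.

Lemma Lam1E s : Lam1 P s = Lam P (col (Ordinal m0) s).
Proof. by rewrite /Lam1 (big_pred1 (Ordinal m0)). Qed.

Lemma Lam_col_linear j (t : R) s h : Y j (t *: s + h) = t *: Y j s + Y j h.
Proof. by rewrite /Y linearP/= Lam_linear. Qed.

Lemma Lam1_linear (t : R) s h : X (t *: s + h) = t *: X s + X h.
Proof. by rewrite /X !Lam1E [LHS]Lam_col_linear. Qed.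

Lemma Lam1_sym s : (Lam1 P s)^T = Lam1 P s.
Proof. by rewrite Lam1E Lam_sym. Qed.

Lemma mulmx_sandwich_sym n (A B : 'M[R]_n) : A^T = A -> B^T = B ->
  (A *m B *m A)^T = A *m B *m A.
Proof. by move=> AT BT; rewrite !trmx_mul AT BT mulmxA. Qed.

Lemma Pi_sym s : (Pi P s)^T = Pi P s.
Proof.
rewrite /Pi linearB/= Lam1_sym linear_sum/=; congr (_ - _); apply: eq_bigr => j _.
by apply: mulmx_sandwich_sym; rewrite ?trmx_inv ?Lam_sym ?Lam1_sym.
Qed.

Lemma Ckmx_Lam_col (D : set V) k j : open D -> Ckmx D k (Y j).
Proof.
move=> oD; apply: CkmxM => //; last exact: Ckmx_cst.
apply: CkmxM => //; first exact: Ckmx_cst.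
move=> i l; under eq_fun do rewrite !mxE.
have [_|_] := eqVneq i l.
  under eq_fun do rewrite mulr1n.
  apply: Ck_linear => //; first exact: coord_continuous.
  by move=> t a b; rewrite !mxE.
by under eq_fun do rewrite mulr0n; exact: Ck_cst.
Qed.

Lemma Ckmx_Lam1 (D : set V) k : open D -> Ckmx D k X.
Proof.
move=> oD; rewrite (_ : X = Y (Ordinal m0)); first exact: Ckmx_Lam_col.
by apply/funext => s; exact: Lam1E.
Qed.

Lemma is_mderive_Lam_col j s h : is_mderive s h (Y j) (Y j h).
Proof.
move=> i l; apply: (is_derive_linear (f := fun y => Y j y i l)) => t a b.
by rewrite Lam_col_linear !mxE.
Qed.

Lemma is_mderive_Lam1 s h : is_mderive s h X (X h).
Proof.
rewrite (_ : X = Y (Ordinal m0)); first exact: is_mderive_Lam_col.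
by apply/funext => y; exact: Lam1E.
Qed.

(* The quadratic form, at [(x, z_1, ..., z_(m-1))], of the block arrow matrix with
   diagonal blocks [Lam1] and off-diagonal blocks [- Lam s_j]; it is linear in [s]. *)
Definition arrow s (x : 'cV[R]_L) (z : 'I_m -> 'cV[R]_L) : R :=
  qform (X s) x - 2 * (\sum_(j < m | (0 < j)%N) (z j)^T *m Y j s *m x) 0 0
  + \sum_(j < m | (0 < j)%N) qform (X s) (z j).

Lemma qform_linear n (t : R) (A B : 'M[R]_n) x :
  qform (t *: A + B) x = t * qform A x + qform B x.
Proof. by rewrite qformD /qform -scalemxAr -scalemxAl mxE. Qed.

Lemma arrow_linear (t : R) s h x z :
  arrow (t *: s + h) x z = t * arrow s x z + arrow h x z.
Proof.
rewrite /arrow Lam1_linear qform_linear.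
under [X in _ + X]eq_bigr => j _ do rewrite qform_linear.
rewrite big_split/= -mulr_sumr.
have -> : \sum_(j < m | (0 < j)%N) (z j)^T *m Y j (t *: s + h) *m x =
    t *: (\sum_(j < m | (0 < j)%N) (z j)^T *m Y j s *m x) +
    \sum_(j < m | (0 < j)%N) (z j)^T *m Y j h *m x.
  rewrite scaler_sumr -big_split/=; apply: eq_bigr => j _.
  by rewrite Lam_col_linear mulmxDr mulmxDl -scalemxAr -scalemxAl.
move: (\sum_(j < m | _) _) (\sum_(j < m | _) (z j)^T *m Y j h *m x) => a b.
by rewrite !mxE; ring.
Qed.

Lemma arrow0 x z : arrow 0 x z = 0.
Proof.
have /eqP := arrow_linear 1 0 0 x z; rewrite scale1r addr0 mul1r.
by rewrite -subr_eq0 opprD addNKr oppr_eq0 => /eqP.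
Qed.

Lemma arrow_continuous x z : continuous (fun s => arrow s x z).
Proof.
have oT : open (setT : set V) by exact: openT.
have Cc n p (A : 'M[R]_(n, p)) : Ckmx (setT : set V) 0 (fun=> A) by exact: Ckmx_cst.
have Cq y : Ck setT 0 (fun s => qform (X s) y).
  by do 2!apply: CkmxM => //; exact: Ckmx_Lam1.
suff : Ck setT 0 (fun s => arrow s x z) by move=> C s; exact: Ck_cont C I.
apply: CkD => //; last exact: Ck_sum.
apply: CkD => //; apply: CkN => //; apply: CkM => //; first exact: Ck_cst.
apply: Ckmx_sum => // j; do 2!apply: CkmxM => //; exact: Ckmx_Lam_col.
Qed.

Lemma qform_complete_square n (A B : 'M[R]_n) x z : A^T = A -> B^T = B -> A \in unitmx ->
  qform A (z - invmx A *m B *m x) =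
  qform A z - 2 * (z^T *m B *m x) 0 0 + qform (B *m invmx A *m B) x.
Proof.
move=> AT BT Au; rewrite /qform; set w := invmx _ *m _ *m x.
have AwE : A *m w = B *m x by rewrite /w -!mulmxA mulKVmx.
have wAE : w^T *m A = x^T *m B by rewrite -{1}AT -trmx_mul AwE trmx_mul BT.
rewrite [(z - w)^T]linearB/= !mulmxBl !mulmxBr -[z^T *m A *m w]mulmxA AwE wAE.
have -> : x^T *m B *m z = (z^T *m (B *m x))^T by rewrite 2!trmx_mul trmxK BT.
rewrite /w !mulmxA.
move: (z^T *m A *m z) (z^T *m B *m x) (_ *m x) => a b c.
by rewrite !mxE; ring.
Qed.

(** Completing the square in each [z j] leaves the Schur complement in [x]. All squares vanish at
    [z j = X^-1 Y_j x], the substitution by which later proofs isolate [Pi]. *)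
Lemma arrow_square s x z : X s \in unitmx ->
  arrow s x z = qform (Pi P s) x +
    \sum_(j < m | (0 < j)%N) qform (X s) (z j - invmx (X s) *m Y j s *m x).
Proof.
move=> Xu.
have E j := qform_complete_square x (z j) (Lam1_sym s) (Lam_sym (col j s)) Xu.
under eq_bigr => j _ do rewrite E.
rewrite !big_split/= /arrow sumrN -mulr_sumr summxE.
have -> : qform (Pi P s) x = qform (X s) x -
    \sum_(j < m | (0 < j)%N) qform (Y j s *m invmx (X s) *m Y j s) x.
  rewrite /Pi addrC -scaleN1r qform_linear mulN1r addrC; congr (_ - _).
  by rewrite /qform mulmx_sumr mulmx_suml summxE.
by ring.
Qed.

(** Taking [z = 0] recovers positivity of [Lam1], after which the minimising [z] recovers that of
    [Pi]. The conditions on the right are linear in [s], unlike the definition of [Kint]. *)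
Lemma KintP s : Kint m P s <-> forall x z, x != 0 -> 0 < arrow s x z.
Proof.
split=> [[Xpos Ppos] x z xN0|apos].
  rewrite arrow_square; last exact: posdef_unit.
  rewrite ltr_pwDl//; first by case: Ppos => _; exact.
  by apply: sumr_ge0 => j _; exact: posdef_ge0.
have Xpos : posdef (X s).
  split; first exact: Lam1_sym.
  move=> x xN0; have := apos x (fun=> 0) xN0.
  rewrite /arrow [\sum_(j < m | _) _ *m x]big1; last by move=> j _; rewrite trmx0 !mul0mx.
  rewrite mxE mulr0 subr0 big1 ?addr0// => j _.
  by rewrite /qform mulmx0 mxE.
split=> //; split.
  exact: Pi_sym.
move=> x xN0; have := apos x (fun j => invmx (X s) *m Y j s *m x) xN0.
rewrite arrow_square; last exact: posdef_unit.
rewrite big1 ?addr0// => j _; by rewrite subrr /qform mulmx0 mxE.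
Qed.

Lemma Kint_arrow_ge0 s x z : Kint m P s -> 0 <= arrow s x z.
Proof.
move=> sK; have [x0|xN0] := eqVneq x 0; last by apply/ltW/(KintP _).1.
rewrite arrow_square; last by apply: posdef_unit; case: sK.
rewrite addr_ge0//; first by apply: posdef_ge0; case: sK.
by apply: sumr_ge0 => j _; apply: posdef_ge0; case: sK.
Qed.

(** First column all ones, the others zero: both [Lam1] and [Pi] become [P^T *m P], positive
    definite because [P] is injective. *)
Let s0 : V := \matrix_(u, j) ((j : nat) == 0%N)%:R.

Lemma Kint_s0 : Kint m P s0.
Proof.
have Y0 (j : 'I_m) : (0 < j)%N -> Y j s0 = 0.
  move=> j0; rewrite /Y (_ : col j s0 = 0); last first.
    by apply/matrixP => u i; rewrite !mxE eqn0Ngt j0.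
  by rewrite /Lam trmx0 linear0 mulmx0 mul0mx.
have X0 : X s0 = P^T *m P.
  rewrite /X Lam1E /Lam (_ : diag_mx _ = 1%:M) ?mulmx1//.
  by apply/matrixP => u v; rewrite !mxE.
have Xpos : posdef (X s0).
  rewrite X0; split; first by rewrite trmx_mul trmxK.
  move=> x xN0; rewrite mulmxA -trmx_mul -mulmxA -trace_mx11 lt_neqAle trace_sqr_ge0.
  rewrite andbT eq_sym; apply: contra xN0 => /eqP/trace_sqr_eq0/Pfull ->//.
split=> //; rewrite /Pi big1 ?subr0// => j j0.
by rewrite -/(Y j s0) Y0// mulmx0.
Qed.

(** Nonnegativity passes to the closure by continuity. Conversely, adding a small positive multiple
    of [s0] makes the form strictly positive, so [s] is a limit of points of [Kint]. *)
Lemma KstarP s : Kstar m P s <-> forall x z, 0 <= arrow s x z.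
Proof.
split=> [sK x z|sge0 B sB].
  rewrite leNgt; apply/negP => slt0.
  have /cvgr_lt/(_ 0 slt0) : arrow y x z @[y --> s] --> arrow s x z.
    exact: arrow_continuous.
  by move=> /sK[y [/(@Kint_arrow_ge0 _ x z)]]; rewrite leNgt /= => /negP.
have c := @cvg_ray _ V s0 s; have : \forall t \near (0 : R)^'+, B (t *: s0 + s) by exact: c.
move=> nB; near (0 : R)^'+ => t; exists (t *: s0 + s); split; last by near: t.
apply/KintP => x z xN0; rewrite arrow_linear ltr_pwDl//.
by rewrite mulr_gt0//; apply: (KintP _).1 => //; exact: Kint_s0.
Unshelve. all: by end_near. Qed.

(** Two stages: [Lam1] is continuous everywhere, and [Pi] is continuous on the open set where [Lam1]
    is positive definite. *)
Lemma open_Kint : open (Kint m P).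
Proof.
have oT : open (setT : set V) by exact: openT.
have oD : open [set s : V | setT s /\ posdef (X s)].
  by apply: open_posdef => //; [exact: Ckmx_Lam1|move=> y _; exact: Lam1_sym].
have -> : Kint m P = [set s | [set s : V | setT s /\ posdef (X s)] s /\ posdef (Pi P s)].
  by apply/seteqP; split=> s /=; [move=> []|move=> [[_ ? ?]]].
apply: open_posdef => //.
  apply: (@Ckmx_schur _ _ _ _ _ (fun j : 'I_m => (0 < j)%N) X Y) => //.
  - by move=> y [].
  - by move=> k; exact: Ckmx_Lam1.
  - by move=> i k; exact: Ckmx_Lam_col.
by move=> y _; exact: Pi_sym.
Qed.

(** From an interior point [s], a small step along [- s0] stays in the closed cone; undoing it adds
    a strictly positive multiple of the form at [s0]. *)
Lemma interior_Kstar : interior (Kstar m P) = Kint m P.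
Proof.
apply/seteqP; split=> s.
  rewrite /interior => sK.
  have c := @cvg_ray _ V (- s0) s.
  have nK : \forall t \near (0 : R)^'+, Kstar m P (t *: - s0 + s) by exact: c _ sK.
  near (0 : R)^'+ => t.
  have /KstarP tK : Kstar m P (t *: - s0 + s) by near: t.
  apply/KintP => x z xN0.
  have -> : s = t *: s0 + (t *: - s0 + s) by rewrite scalerN addNKr.
  rewrite arrow_linear ltr_pwDl// mulr_gt0//; apply: (KintP _).1 => //; exact: Kint_s0.
move=> sK; apply: (@filterS _ _ _ (Kint m P)); first exact: subset_closure.
by apply: open_nbhs_nbhs; split; [exact: open_Kint|].
Unshelve. all: by end_near. Qed.

Lemma Kstar_closed_convex_cone : closed_convex_cone (Kstar m P).
Proof.
split.
- exact: closed_closure.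
- move=> x y l /KstarP xK /KstarP yK /andP[l0 l1]; apply/KstarP => a z.
  rewrite arrow_linear -[(1 - l) *: y]addr0 arrow_linear arrow0.
  by rewrite addr0 addr_ge0// mulr_ge0// subr_ge0.
- move=> x t /KstarP xK t0; apply/KstarP => a z.
  by rewrite -[t *: x]addr0 arrow_linear arrow0 addr0 mulr_ge0.
- by exists s0; rewrite interior_Kstar; exact: Kint_s0.
Qed.

End Cone.

(** * Convexity from second derivatives, and smoothness in the required form *)

Lemma convex_of_second_derivative (R : realType) (V : normedModType R) (D : set V)
    (F : V -> R) : open D ->
  (forall x y l, D x -> D y -> 0 <= l <= 1 -> D (l *: x + (1 - l) *: y)) ->
  Ck D 2 F -> (forall x h, D x -> 0 <= dd h (dd h F) x) ->
  forall x y l, D x -> D y -> 0 <= l <= 1 ->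
    F (l *: x + (1 - l) *: y) <= l * F x + (1 - l) * F y.
Proof.
move=> oD cD CF F2 x y l Dx Dy /andP[l0 l1].
(* On the segment from [x] to [y] the second derivative of [F] is [dd h (dd h F)], so a one-variable
   convexity criterion on the unit interval suffices. *)
pose h := y - x; pose g (t : R) : V := t *: h + x.
pose f (t : R) : R^o := F (g t).
have gE t : g t = (1 - t) *: x + (1 - (1 - t)) *: y.
  by rewrite /g /h subKr scalerBr scalerBl scale1r addrC addrA addrAC.
have gD t : 0 <= t <= 1 -> D (g t).
  by move=> /andP[t0 t1]; rewrite gE; apply: cD => //; rewrite subr_ge0 t1 gerBl t0.
have gc : continuous g.
  by move=> t; apply: cvgD; [apply: cvgZr_tmp; exact: cvg_id|exact: cvg_cst].
have oG : open (g @^-1` D) by apply: open_comp => // t _; exact: gc.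
have f1 t : D (g t) -> is_derive t 1 f (dd h F (g t)).
  move=> Dt; exact: (is_derive_line F x h t _).1 (CkS_is_derive h CF Dt).
have f2 t : D (g t) -> is_derive t 1 ('D_1 f) (dd h (dd h F) (g t)).
  move=> Dt.
  have := (is_derive_line (dd h F) x h t _).1 (CkS_is_derive h (CkS_dd h CF) Dt).
  apply: near_eq_is_derive.
  have : \forall s \near t, (g @^-1` D) s by apply: open_nbhs_nbhs; split.
  by apply: filterS => s /f1[_ ->].
have fc t : D (g t) -> {for t, continuous f}.
  by move=> Dt; apply: (@continuous_comp _ _ _ g F); [exact: gc|exact: Ck_cont CF Dt].
have in01 t : t \in `]0, 1[ -> D (g t).
  by rewrite in_itv/= => /andP[t0 t1]; apply: gD; rewrite !ltW.
have f2_ge0 t : 0 < t < 1 -> 0 <= 'D_1 ('D_1 f) t.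
  move=> t01; have Dt : D (g t) by apply: in01; rewrite in_itv.
  by have [_ ->] := f2 t Dt; exact: F2.
have left1 : f t @[t --> 1^'-] --> f 1.
  by apply: cvg_at_left_filter; apply: fc; apply: gD; rewrite ler01 lexx.
have right0 : f t @[t --> 0^'+] --> f 0.
  by apply: cvg_at_right_filter; apply: fc; apply: gD; rewrite ler01 lexx.
have d1 : {in `]0, 1[, forall t : R, derivable f t 1} by move=> t /in01/f1[].
have d2 : {in `]0, 1[, forall t : R, derivable ('D_1 f) t 1} by move=> t /in01/f2[].
(* The point [l *: x + (1 - l) *: y] is [g (1 - l)]. *)
have := second_derivative_convex f2_ge0 left1 right0 d1 d2 (Itv01 l0 l1) ler01.
rewrite !convRE/= /unstable.onem mulr0 add0r mulr1 /f !gE.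
by rewrite subKr !subr0 !subrr subr0 !scale1r !scale0r addr0 add0r.
Qed.

Lemma Ck_C3_on (R : realType) (V : normedModType R) (D : set V) (F : V -> R) :
  Ck D 3 F -> C3_on D F.
Proof.
move=> C h1 h2 h3 x Dx.
have C1 := CkS_dd h1 C; have C2 := CkS_dd h2 C1; have C3 := CkS_dd h3 C2.
split; first exact: Ck_cont C Dx.
split; first by have [] := CkS_is_derive h1 C Dx.
split; first exact: Ck_cont C1 Dx.
split; first by have [] := CkS_is_derive h2 C1 Dx.
split; first exact: Ck_cont C2 Dx.
split; first by have [] := CkS_is_derive h3 C2 Dx.
exact: Ck_cont C3 Dx.
Qed.

Lemma LHSCB_intro (R : realType) (V : normedModType R) (K D : set V) (F : V -> R) (nu : R) :
  interior K = D -> closed_convex_cone K -> C3_on D F ->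
  [/\ (forall x y l, D x -> D y -> 0 <= l <= 1 ->
         F (l *: x + (1 - l) *: y) <= l * F x + (1 - l) * F y),
      (forall (u : nat -> V) (x : V), (forall k, D (u k)) ->
         u @ \oo --> x -> K x -> ~ D x -> (F \o u) @ \oo --> +oo),
      (forall x h, D x ->
         `| dd h (dd h (dd h F)) x | <= 2 * (dd h (dd h F) x) `^ (3 / 2))
    & (forall x tau, D x -> 0 < tau -> F (tau *: x) = F x - nu * ln tau)] ->
  LHSCB K F nu.
Proof. by move=> <-. Qed.

(** * Boundary behaviour, homogeneity and assembly of the barrier *)

Section Barrier.
Variables (R : realType) (U L m : nat) (P : 'M[R]_(U, L)).
Hypotheses (Pfull : forall v : 'cV[R]_L, P *m v = 0 -> v = 0) (m0 : (0 < m)%N).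
Local Notation V := 'M[R]_(U, m).
Implicit Types (s h : V).
Let Y (j : 'I_m) s := Lam P (col j s).
Let X s := Lam1 P s.

(** At [z = 0] the completed square expresses the form of [Lam1] as that of [Pi] plus nonnegative
    terms. *)
Lemma qform_Pi_le s x : posdef (X s) -> qform (Pi P s) x <= qform (X s) x.
Proof.
move=> Xpos; have := arrow_square m0 x (fun=> 0) (posdef_unit Xpos).
rewrite /arrow [\sum_(j < m | _) _ *m x]big1; last by move=> j _; rewrite trmx0 !mul0mx.
rewrite mxE mulr0 subr0 [X in _ + X = _]big1 ?addr0; last first.
  by move=> j _; rewrite /qform mulmx0 mxE.
by move=> ->; rewrite lerDl sumr_ge0// => j _; exact: posdef_ge0.
Qed.

Lemma Pi_possemidef s x : Kstar m P s -> X s \in unitmx -> 0 <= qform (Pi P s) x.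
Proof.
move=> /(KstarP Pfull m0) sK Xu.
have := sK x (fun j => invmx (X s) *m Y j s *m x); rewrite arrow_square//.
by rewrite big1 ?addr0// => j _; rewrite subrr /qform mulmx0 mxE.
Qed.

Lemma Lam1_possemidef s x : Kstar m P s -> 0 <= qform (X s) x.
Proof.
move=> /(KstarP Pfull m0) sK; have := sK x (fun=> 0).
rewrite /arrow [\sum_(j < m | _) _ *m x]big1; last by move=> j _; rewrite trmx0 !mul0mx.
rewrite mxE mulr0 subr0 [X in _ <= _ + X]big1 ?addr0//.
by move=> j _; rewrite /qform mulmx0 mxE.
Qed.

(** [Pi] contains the inverse of [Lam1] and need not converge where [Lam1] degenerates. This bound
    depends only on the trace of [Lam1], which is continuous everywhere. *)
Lemma det_Pi_le s : Kint m P s ->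
  `|\det (Pi P s)| <= L`!%:R * (2 * \tr (X s)) ^+ L.
Proof.
move=> [Xpos Ppos]; apply: det_norm_le => i j.
have X_ge0 k : 0 <= X s k k by rewrite -qform_delta posdef_ge0.
have diag k : X s k k <= \tr (X s) by rewrite /mxtrace (bigD1 k)//= lerDl sumr_ge0.
apply: le_trans (loewner_entry_le (B := X s) i j _ _) _.
- by case: Ppos.
- by move=> x; rewrite posdef_ge0//= qform_Pi_le.
- by rewrite mulrDl mul1r lerD.
Qed.

Lemma det_Lam1_continuous : continuous (fun s => \det (X s)).
Proof.
have oT : open (setT : set V) by exact: openT.
by move=> s; apply: Ck_cont (Ck_det oT (Ckmx_Lam1 P m0 0 oT)) _.
Qed.

(** Continuity is needed at limit points outside [Kint], so it is established on the larger open set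
    where only [Lam1] is positive definite. *)
Lemma det_Pi_continuous s : posdef (X s) -> {for s, continuous (fun s => \det (Pi P s))}.
Proof.
have oT : open (setT : set V) by exact: openT.
move=> Xpos; have oD : open [set s : V | setT s /\ posdef (X s)].
  by apply: open_posdef => //; [exact: Ckmx_Lam1|move=> y _; exact: Lam1_sym].
apply: (@Ck_cont _ _ [set s : V | setT s /\ posdef (X s)] 0) => //.
apply: Ck_det => //; apply: (@Ckmx_schur _ _ _ _ _ (fun j : 'I_m => (0 < j)%N) X Y) => //.
- by move=> y [].
- by move=> k; exact: Ckmx_Lam1.
- by move=> i k; exact: Ckmx_Lam_col.
Qed.

Lemma det_product_cvg0 (u : nat -> V) s : (forall k, Kint m P (u k)) ->
  u @ \oo --> s -> Kstar m P s -> ~ Kint m P s ->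
  (\det (Pi P (u k)) * \det (X (u k))) @[k --> \oo] --> (0 : R).
Proof.
move=> uK us sK sN.
have uc (f : V -> R) : {for s, continuous f} -> f (u k) @[k --> \oo] --> f s.
  by move=> fc; apply: cvg_comp us fc.
have dX := uc _ (@det_Lam1_continuous s).
have [Xs0|XsN0] := eqVneq (\det (X s)) 0.
  (* Singular [Lam1] at the limit: the determinant of [Pi] stays bounded while that of [Lam1] tends
     to zero. *)
  pose b s : R := L`!%:R * (2 * \tr (X s)) ^+ L * \det (X s).
  have b_cont : {for s, continuous b}.
    have oT : open (setT : set V) by exact: openT.
    have CX : Ckmx (setT : set V) 0 X by exact: Ckmx_Lam1.
    suff Cb : Ck setT 0 b by exact: Ck_cont Cb I.
    apply: (CkM oT); last exact: Ck_det.
    apply: (CkM oT); first exact: Ck_cst.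
    apply: (CkX oT); apply: (CkM oT); first exact: Ck_cst.
    by apply: Ck_sum => // i; exact: CX.
  have bc : b (u k) @[k --> \oo] --> (0 : R).
    have -> : 0 = b s by rewrite /b Xs0 mulr0.
    exact: uc.
  apply: squeeze_cvgr (cvg_cst 0) bc; near=> k.
  have [Xk Pk] := uK k; have Xk0 := posdef_det_gt0 Xk; have Pk0 := posdef_det_gt0 Pk.
  rewrite mulr_ge0 ?(ltW Pk0) ?(ltW Xk0)//= /b ler_wpM2r ?(ltW Xk0)//.
  by apply: le_trans (ler_norm _) _; exact: det_Pi_le.
have Xu : X s \in unitmx by rewrite unitmxE unitfE.
have Xpos : posdef (X s).
  apply: possemidef_unit_posdef => //; first exact: Lam1_sym.
  by move=> x; exact: Lam1_possemidef.
(* Invertible [Lam1] at the limit: [Pi] is positive semidefinite there, and if it were also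
   invertible then [s] would lie in [Kint]. *)
have -> : 0 = \det (Pi P s) * \det (X s).
  have [->|PN0] := eqVneq (\det (Pi P s)) 0; first by rewrite mul0r.
  exfalso; apply: sN; split=> //; apply: possemidef_unit_posdef.
  - exact: Pi_sym.
  - by rewrite unitmxE unitfE.
  - by move=> x; exact: Pi_possemidef.
by apply: cvgM dX; exact: uc (det_Pi_continuous Xpos).
Unshelve. all: by end_near. Qed.

Lemma Fbar_cvg_pinfty (u : nat -> V) s : (forall k, Kint m P (u k)) ->
  u @ \oo --> s -> Kstar m P s -> ~ Kint m P s -> (Fbar P \o u) @ \oo --> +oo.
Proof.
move=> uK us sK sN; have p0 := det_product_cvg0 uK us sK sN.
apply/cvgryPge => a; have /cvgr_lt/(_ (expR (- a)) (expR_gt0 _)) := p0.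
apply: filterS => k pk; rewrite /= /Fbar -opprD lerNr -lnM; first last.
- by rewrite posrE posdef_det_gt0//; case: (uK k).
- by rewrite posrE posdef_det_gt0//; case: (uK k).
rewrite -[leRHS]expRK ler_ln ?posrE ?expR_gt0//; first exact: ltW.
by rewrite mulr_gt0// posdef_det_gt0//; case: (uK k).
Qed.

(** [Lam1] and [Pi] both scale by [t], so each of the two determinants of order [L] contributes [L]
    times [ln t]. *)
Lemma Fbar_log_homogeneous s (t : R) : Kint m P s -> 0 < t ->
  Fbar P (t *: s) = Fbar P s - (2 * L)%:R * ln t.
Proof.
move=> [Xpos Ppos] t0; have tN0 : t != 0 by rewrite gt_eqF.
have YE j : Lam P (col j (t *: s)) = t *: Lam P (col j s).
  by rewrite -[t *: s]addr0 Lam_col_linear linear0 {2}/Lam trmx0 linear0 mulmx0 mul0mx addr0.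
have XE : Lam1 P (t *: s) = t *: Lam1 P s by rewrite !(Lam1E _ m0) YE.
have Xu : t *: Lam1 P s \in unitmx by rewrite unitmxZ ?unitfE//; exact: posdef_unit.
have E (A B : 'M[R]_L) : t *: A *m (t^-1 *: B) *m (t *: A) = t *: (A *m B *m A).
  by rewrite -!scalemxAl -!scalemxAr -scalemxAl !scalerA; congr (_ *: _); field.
have PE : Pi P (t *: s) = t *: Pi P s.
  rewrite /Pi XE scalerBr; congr (_ - _); rewrite [RHS]scaler_sumr; apply: eq_bigr => j _.
  by rewrite YE invmxZ// E.
rewrite /Fbar PE XE !detZ !lnM ?posrE ?exprn_gt0 ?posdef_det_gt0// lnXn//.
by rewrite natrM -mulr_natl; ring.
Qed.

Lemma Kint_convex x y (l : R) : Kint m P x -> Kint m P y -> 0 <= l <= 1 ->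
  Kint m P (l *: x + (1 - l) *: y).
Proof.
move=> /(KintP P m0) xK /(KintP P m0) yK /andP[l0 l1]; apply/(KintP P m0) => a z aN0.
rewrite arrow_linear// -[(1 - l) *: y]addr0 arrow_linear// arrow0// addr0.
(* Strict positivity comes from [x] when [l] is positive and from [y] when [l = 0]. *)
have [->|lN0] := eqVneq l 0; first by rewrite mul0r add0r subr0 mul1r yK.
rewrite ltr_pwDl// ?mulr_gt0 ?xK ?lt0r ?lN0// mulr_ge0 ?subr_ge0// ltW// yK//.
Qed.

Lemma Fbar_LHSCB : LHSCB (Kstar m P) (Fbar P) (2 * L)%:R.
Proof.
have oK : open (Kint m P) by exact: open_Kint.
have CX k : Ckmx (Kint m P) k X by exact: Ckmx_Lam1.
have CY j k : Ckmx (Kint m P) k (Y j) by exact: Ckmx_Lam_col.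
have Xpos y : Kint m P y -> posdef (X y) by case.
have Ppos y : Kint m P y -> posdef (Pi P y) by case.
have CF k : Ck (Kint m P) k (Fbar P).
  exact: (@Ck_schur_barrier _ _ _ _ _ (fun j : 'I_m => (0 < j)%N) X Y).
have SC x h : Kint m P x -> 0 <= dd h (dd h (Fbar P)) x /\
    `|dd h (dd h (dd h (Fbar P))) x| <= 2 * (dd h (dd h (Fbar P)) x) `^ (3 / 2).
  (* By linearity the derivatives in direction [h] are the values of [X] and [Y j] at [h]. The sign
     of the second derivative is kept for convexity. *)
  apply: (@schur_barrier_self_concordant _ _ _ _ _ (fun j : 'I_m => (0 < j)%N) X Y
    h (X h) (Y^~ h)) => //.
  - by move=> i y; exact: Lam_sym.
  - exact: Lam1_sym.
  - by move=> i; exact: Lam_sym.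
  - by move=> y; exact: is_mderive_Lam1.
  - by move=> i y; exact: is_mderive_Lam_col.
have intK : interior (Kstar m P) = Kint m P by exact: interior_Kstar.
apply: LHSCB_intro intK _ _ _; first exact: Kstar_closed_convex_cone.
  exact: Ck_C3_on (CF 3).
split.
- exact: convex_of_second_derivative oK Kint_convex (CF 2) (fun x h xK => (SC x h xK).1).
- exact: Fbar_cvg_pinfty.
- exact: (fun x h xK => (SC x h xK).2).
- exact: Fbar_log_homogeneous.
Qed.

End Barrier.

(** * From unisolvence to injectivity of [P], and the conclusion *)

Lemma evmx_full_rank (R : realType) (n d U L : nat) (t : 'I_U -> 'I_n -> R)
    (p : 'I_L -> mpolyR n R) (v : 'cV[R]_L) :
  unisolvent (2 * d) t -> is_basis_polys d p -> evmx t p *m v = 0 -> v = 0.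
Proof.
move=> tU [pd pfree _] Pv.
apply/matrixP => i j; rewrite ord1 mxE.
(* The combination of the [p l] with coefficients [v] has degree at most [d], hence at most [2 * d],
   and vanishes at every node; unisolvence kills it and linear independence kills [v]. *)
apply: (pfree (fun l => v l 0)) => {i j}; apply: tU.
  rewrite /deg_le; apply: leq_trans (msize_sum _ _ _) _.
  apply/bigmax_leqP => l _; apply: leq_trans (msizeZ_le _ _) _.
  by apply: leq_trans (pd l) _; rewrite ltnS mul2n -addnn leq_addr.
move=> u; have := congr1 (fun A : 'cV[R]_U => A u 0) Pv; rewrite !mxE => E.
rewrite raddf_sum/= -[RHS]E; apply: eq_bigr => l _.
by rewrite mevalZ mxE mulrC.
Qed.

Theorem theorem1 (R : realType) (n d m : nat) (t : 'I_('C(n + 2 * d, n)) -> 'I_n -> R)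
  (p : 'I_('C(n + d, n)) -> mpolyR n R) :
  (1 <= n)%N -> (1 <= d)%N -> (2 <= m)%N ->
  unisolvent (2 * d) t -> is_basis_polys d p ->
  let P := evmx t p in
  interior (Kstar m P) = Kint m P /\
  LHSCB (Kstar m P) (Fbar P) (2 * 'C(n + d, n))%:R.
Proof.
move=> _ _ m2 tU pB P; have m0 : (0 < m)%N by exact: ltnW.
have Pfull (v : 'cV[R]_('C(n + d, n))) : P *m v = 0 -> v = 0.
  exact: evmx_full_rank tU pB.
by split; [exact: interior_Kstar|exact: Fbar_LHSCB].
Qed.
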